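(* Let $x \in \mathcal{M}(\Omega;V)$ be an independent initial. Then $(\mathbb{X}_{x}(t))_{t \geq 0}$ is a Markov process with respect to $(\mathcal{F}_{t}^{x})_{t \geq 0}$, i.e. $$\mathbb{P}(\mathbb{X}_{x}(t+h)\in B\,|\,\mathcal{F}_{t}^{x})=\mathbb{P}(\mathbb{X}_{x}(t+h)\in B\,|\,\mathbb{X}_{x}(t))$$ almost surely, for all $t,h \in [0,\infty)$ and $B \in \mathfrak{B}(V)$. In addition, $P$ is a time homogeneous transition function, that is: (i) $\mathfrak{B}(V)\ni B \mapsto P(t,v,B)$ is a probability measure on $(V,\mathfrak{B}(V))$, for all $t \in [0,\infty)$ and $v \in V$; (ii) $P(0,v,B)=\mathbf{1}_{B}(v)$ for all $v \in V$ and $B \in \mathfrak{B}(V)$; (iii) $P(\cdot,\cdot,B)$ is $\mathfrak{B}([0,\infty))\otimes \mathfrak{B}(V)$-$\mathfrak{B}([0,1])$-measurable for every $B \in \mathfrak{B}(V)$; (iv) $P$ has the Chapman-Kolmogorov property, i.e. $P(t+h,v,B)=\int_{V} P(h,\hat{v},B)\,P(t,v,d\hat{v})$ for all $t,h \in [0,\infty)$, $v \in V$ and $B \in \mathfrak{B}(V)$. Moreover, $(\mathbb{X}_{x}(t))_{t \geq 0}$ is time homogeneous with initial distribution $\mathbb{P}_{x}$ (the law of $x$) and transition function $P$, i.e. $$\mathbb{P}(\mathbb{X}_{x}(t+h)\in B\,|\,\mathcal{F}_{t}^{x})=P(h,\mathbb{X}_{x}(t),B)$$ almost surely, for all $t,h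 \in [0,\infty)$ and $B \in \mathfrak{B}(V)$.
   Context: $(\Omega,\mathcal{F},\mathbb{P})$ is a complete probability space, $(V,\|\cdot\|_V)$ is a separable real Banach space with Borel $\sigma$-algebra $\mathfrak{B}(V)$, and $\mathcal{M}(\Omega;V)$ is the set of all $V$-valued random variables ($\mathcal{F}$-$\mathfrak{B}(V)$-measurable maps). A semigroup on $V$ is a family of (not necessarily linear) maps $T(t):V\to V$, $t\ge 0$, with $T(0)v=v$ and $T(t+h)v=T(t)T(h)v$ for all $t,h\ge0$, $v\in V$; it is time-continuous if $t\mapsto T(t)v$ is continuous on $[0,\infty)$ for every $v\in V$, and contractive if $\|T(t)v_1-T(t)v_2\|_V\le\|v_1-v_2\|_V$ for all $t\ge0$, $v_1,v_2\in V$. Standing assumptions: $(T(t))_{t\ge0}$ is a time-continuous, contractive semigroup on $V$; $(\eta_m)_{m\in\mathbb{N}}\subseteq\mathcal{M}(\Omega;V)$ is i.i.d.; $(\beta_m)_{m\in\mathbb{N}}$, $\beta_m:\Omega\to(0,\infty)$, is an i.i.d. sequence of exponentially distributed random variables with parameter $\theta\in(0,\infty)$; the two sequences are independent of each other. Set $\alpha_0:=0$, $\alpha_m:=\sum_{k=1}^m\beta_k$. An $x\in\mathcal{M}(\Omega;V)$ is an independent initial if $x$ is jointly independent of $((\eta_m)_{m\in\mathbb{N}},(\beta_m)_{m\in\mathbb{N}})$; every constant $v\in V$ is identified with the constant random variable and is an independent initial. For an independent initial $x$ set $\mathsf{x}_{x,0}:=x$, $\mathsf{x}_{x,m}:=T(\beta_m)\mathsf{x}_{x,m-1}+\eta_m$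 for $m\in\mathbb{N}$, and $\mathbb{X}_x(t):=\sum_{m=0}^\infty T((t-\alpha_m)_+)(\mathsf{x}_{x,m})\mathbf{1}_{[\alpha_m,\alpha_{m+1})}(t)$ for $t\ge0$. $\mathcal{F}^x_t:=\sigma_0(\mathbb{X}_x(\tau);\tau\in[0,t])$, where $\sigma_0(\cdot)$ denotes the completion of the generated $\sigma$-algebra, i.e. all $A\in\mathcal{F}$ for which there is $B$ in the generated $\sigma$-algebra with $\mathbb{P}(A\Delta B)=0$. Finally $P:[0,\infty)\times V\times\mathfrak{B}(V)\to[0,1]$ is defined by $P(t,v,B):=\mathbb{P}(\mathbb{X}_v(t)\in B)$. *)

(* Defs.v *)
From HB Require Import structures.
From mathcomp Require Import all_boot all_order all_algebra.
From mathcomp Require Import all_classical all_reals all_analysis.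
From mathcomp Require Import measurable_realfun.

Set Implicit Arguments.
Unset Strict Implicit.
Unset Printing Implicit Defensive.

Import Order.TTheory GRing.Theory Num.Theory.
Import numFieldNormedType.Exports.

Local Open Scope classical_set_scope.
Local Open Scope ring_scope.

(* The carrier of [borel V] is [V] itself, equipped with the sigma-algebra
   generated by the open sets. *)
Notation borel V := (g_sigma_algebraType (@open V)).

Definition separable (V : topologicalType) : Prop :=
  exists D : set V, countable D /\ dense D.

Section semigroup.
Context {R : realType} {V : completeNormedModType R}.

(* Semigroups are indexed by all of [R]; only their values at times [t >= 0]
   are ever constrained or used. *)
Implicit Type T : R -> V -> V.

Definition semigroup T : Prop :=
  (forall v, T 0 v = v) /\
  (forall t h v, 0 <= t -> 0 <= h -> T (t + h) v = T t (T h v)).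

Definition time_continuous T : Prop :=
  forall v, {within `[0, +oo[, continuous (fun t : R => T t v)}.

Definition contractive T : Prop :=
  forall t v1 v2, 0 <= t -> `|T t v1 - T t v2| <= `|v1 - v2|.

End semigroup.

Section sigma_algebras.
Context {d} {Omega : measurableType d} {R : realType}.
Variable P : probability Omega R.

Definition sub_sigma_algebra (G : set (set Omega)) : Prop :=
  sigma_algebra setT G /\ G `<=` measurable.

Definition sigma_gen {d'} {E : measurableType d'} {I : Type} (J : set I)
    (X : I -> Omega -> E) : set (set Omega) :=
  <<s \bigcup_(i in J) g_sigma_algebra_preimage (X i) >>.

Definition sigma_completion (G : set (set Omega)) : set (set Omega) :=
  [set A | measurable A /\ exists2 B, G B & P (A `+` B) = 0%E].

Definition independent_algebras (G H : set (set Omega)) : Prop :=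
  forall A B, G A -> H B -> P (A `&` B) = (P A * P B)%E.

Definition independent_family {d'} {E : measurableType d'} {I : choiceType}
    (X : I -> Omega -> E) : Prop :=
  forall (s : seq I) (B : I -> set E), uniq s -> (forall i, measurable (B i)) ->
    P (\bigcap_(i in [set` s]) X i @^-1` B i) =
    (\prod_(i <- s) P (X i @^-1` B i))%E.

Definition iid {d'} {E : measurableType d'} (X : nat -> Omega -> E) : Prop :=
  independent_family X /\
  (forall m n B, measurable B -> P (X m @^-1` B) = P (X n @^-1` B)).

Section conditional_probability.

Definition is_cond_prob (G : set (set Omega)) (A : set Omega)
    (Y : Omega -> R) : Prop :=
  [/\ forall B : set R, measurable B -> G (Y @^-1` B),
      P.-integrable setT (EFin \o Y) &
      forall C, G C -> (\int[P]_(w in C) (Y w)%:E)%E = P (A `&` C)].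

(* A chosen version of the conditional probability of [A] given [G]. The lemma
   [cond_probP] below shows that the default value is not used when [G] is a
   sub-sigma-algebra. *)
Definition cond_prob (G : set (set Omega)) (A : set Omega) : Omega -> R :=
  xget (cst 0) [set Y | is_cond_prob G A Y].

Lemma factor_cond_prob_ex {d'} {E : measurableType d'} (phi : {mfun Omega >-> E})
    (A : set Omega) : measurable A ->
  exists f : E -> R, [/\ measurable_fun setT f,
    P.-integrable setT (EFin \o (f \o phi)) &
    forall C, measurable C ->
      (\int[P]_(w in phi @^-1` C) (f (phi w))%:E)%E = P (A `&` phi @^-1` C)].
Proof.
move=> mA.
pose mu : probability E R := distribution P phi.
have mphi : measurable_fun setT phi by [].
have mpre C : measurable C -> measurable (phi @^-1` C).
  by move=> mC; rewrite -[_ @^-1` _]setTI; exact: measurable_funP.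
pose m : {measure set Omega -> \bar R} := mrestr P mA.
pose n0 : {measure set E -> \bar R} := pushforward m phi.
pose n := n0 mphi.
have nE C : n C = P (phi @^-1` C `&` A) by [].
have nfin : fin_num_fun n.
  move=> C mC; rewrite nE fin_num_measure//.
  by apply: measurableI => //; exact: mpre.
pose nF : {finite_measure set E -> \bar R} :=
  HB.pack (n : set E -> \bar R) (Measure.class n)
    (Measure_isFinite.Build _ _ _ (n : set E -> \bar R) nfin).
pose nu : {charge set E -> \bar R} := charge_of_finite_measure nF.
have numu : nu `<< mu.
  apply/null_content_dominatesP => C mC C0.
  apply/eqP; rewrite eq_le measure_ge0 andbT -[leRHS]C0.
  apply: (@le_measure _ _ _ P); rewrite ?inE; last by move=> w [].
    by apply: measurableI => //; exact: mpre.
  exact: mpre.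
pose g := Radon_Nikodym nu mu.
have gfin y : g y \is a fin_num by exact: Radon_Nikodym_fin_num.
have gi : mu.-integrable setT g by exact: Radon_Nikodym_integrable.
have /integrableP[mg gint] := gi.
have gE : EFin \o (fine \o g) = g by apply/funext => y /=; rewrite fineK.
have igphi : P.-integrable setT (g \o phi).
  apply/integrableP; split.
    exact: (measurable_comp measurableT _ mg).
  apply: le_lt_trans gint.
  rewrite (ge0_integral_pushforward mphi)//.
  exact: measurableT_comp.
exists (fine \o g); split.
- by apply/measurable_EFinP; rewrite gE.
- by rewrite [X in P.-integrable _ X](_ : _ = g \o phi)// -gE.
- move=> C mC; rewrite setIC -nE -[n C]/(nu C) (Radon_Nikodym_integral numu)//.
  rewrite (integral_pushforward mphi)//; last first.
    apply: integrableS igphi => //.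
    exact: mpre.
  by apply: eq_integral => w _; rewrite /= fineK.
Qed.

Lemma cond_prob_ex (G : set (set Omega)) (A : set Omega) :
  sub_sigma_algebra G -> measurable A -> exists Y, is_cond_prob G A Y.
Proof.
move=> [sG Gm] mA.
pose E := g_sigma_algebraType G.
have mE : (measurable : set (set E)) = G.
  exact: measurable_g_measurableTypeE.
have mphi : measurable_fun setT (idfun : Omega -> E).
  by move=> _ C; rewrite mE setTI; exact: Gm.
pose phi : {mfun Omega >-> E} := HB.pack (idfun : Omega -> E)
  (isMeasurableFun.Build _ _ _ _ _ mphi).
have [f [mf fi fE]] := factor_cond_prob_ex phi mA.
exists f; split => //.
- by move=> B mB; rewrite -mE -[X in measurable X]setTI; exact: mf.
- by move=> C GC; apply: fE; rewrite mE.
Qed.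

Lemma cond_probP (G : set (set Omega)) (A : set Omega) :
  sub_sigma_algebra G -> measurable A -> is_cond_prob G A (cond_prob G A).
Proof.
move=> sG mA; rewrite /cond_prob; case: xgetP => // noY.
by have [Y GY] := cond_prob_ex sG mA; case: (noY Y).
Qed.

End conditional_probability.

End sigma_algebras.

Section processes.
Context {d} {Omega : measurableType d} {R : realType}.
Context {d'} {E : measurableType d'}.
Variable P : probability Omega R.
Implicit Types (X : R -> Omega -> E) (F : R -> set (set Omega)).
Implicit Types (Q : R -> E -> set E -> \bar R).

Definition filtration F : Prop :=
  (forall t, 0 <= t -> sub_sigma_algebra (F t)) /\
  (forall s t, 0 <= s -> s <= t -> F s `<=` F t).

Definition adapted F X : Prop :=
  forall t B, 0 <= t -> measurable B -> F t (X t @^-1` B).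

Definition completed_natural_filtration X (t : R) : set (set Omega) :=
  sigma_completion P (sigma_gen `[0, t] X).

Definition markov_process F X : Prop :=
  [/\ filtration F, adapted F X &
      forall t h B, 0 <= t -> 0 <= h -> measurable B ->
        {ae P, forall w,
          cond_prob P (F t) (X (t + h) @^-1` B) w =
          cond_prob P (g_sigma_algebra_preimage (X t))
            (X (t + h) @^-1` B) w}].

Definition transition_function Q : Prop :=
  [/\ forall t v, 0 <= t ->
        exists mu : probability E R, forall B, measurable B -> Q t v B = mu B,
      forall v B, measurable B -> Q 0 v B = (\1_B v)%:E,
      forall B, measurable B ->
        measurable_fun ((`[0, +oo[ : set R) `*` [set: E])
          (fun p : R * E => Q p.1 p.2 B) &
      forall t h v B, 0 <= t -> 0 <= h -> measurable B ->
        Q (t + h) v B = (\int[Q t v]_y Q h y B)%E].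

Definition time_homogeneous F X (mu0 : set E -> \bar R) Q : Prop :=
  (forall B, measurable B -> P (X 0 @^-1` B) = mu0 B) /\
  (forall t h B, 0 <= t -> 0 <= h -> measurable B ->
     {ae P, forall w,
       (cond_prob P (F t) (X (t + h) @^-1` B) w)%:E = Q h (X t w) B}).

End processes.

Section jump_process.
Context {d} {Omega : measurableType d} {R : realType}.
Context {V : completeNormedModType R}.
Variable P : probability Omega R.
Variable T : R -> V -> V.
(* The sequences are indexed from [0]: [eta m] and [beta m] are the random
   variables usually written with index [m + 1]. *)
Variable eta : nat -> Omega -> borel V.
Variable beta : nat -> Omega -> R.

Definition arrival (m : nat) (w : Omega) : R := \sum_(k < m) beta k w.

Fixpoint jump_chain (x : Omega -> borel V) (m : nat) (w : Omega) : V :=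
  if m is m'.+1 then T (beta m' w) (jump_chain x m' w) + (eta m' w : V)
  else x w.

Definition jump_flow (x : Omega -> borel V) (t : R) (w : Omega) : borel V :=
  limn (fun n => \sum_(0 <= m < n)
    (\1_`[arrival m w, arrival m.+1 w[ t : R) *:
      T (Num.max (t - arrival m w) 0) (jump_chain x m w)).

Definition independent_initial (x : Omega -> borel V) : Prop :=
  independent_algebras P (g_sigma_algebra_preimage x)
    <<s sigma_gen setT eta `|` sigma_gen setT beta >>.

Definition transition (t : R) (v : borel V) (B : set (borel V)) : \bar R :=
  P (jump_flow (cst v) t @^-1` B).

End jump_process.

(* Main.v *)
Require Import Defs.
From HB Require Import structures.
From mathcomp Require Import all_boot all_order all_algebra.
From mathcomp Require Import all_classical all_reals all_analysis.
From mathcomp Require Import measurable_realfun lra.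

Set Implicit Arguments.
Unset Strict Implicit.
Unset Printing Implicit Defensive.

Import Order.TTheory GRing.Theory Num.Theory.
Import numFieldNormedType.Exports.

(** Why the theorem holds.  Between jumps the process follows the deterministic
    semigroup, so at time [t] everything still to come is determined by the
    current state, the residual waiting time until the next jump, and the
    later waiting times and jumps.  The exponential law has no memory and the
    driving variables are independent, so, given the past, the residual
    waiting time and the later variables have the same joint law as the
    original ones.  Hence the conditional law of the state at [t + h] is the
    law at time [h] of a copy started afresh from the current state.

    The argument never handles the law of an infinite sequence.  Split [Omega]
    by the number [m] of jumps up to [t] (the event [epoch m t]) and by the
    number [m + k] of jumps up to [t + h].
    - On [epoch m t] an event of the natural filtration coincides with an event
      of the [history] generated by the initial state and the first [m] waiting
      times and jumps ([natural_history_trace]).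
    - That history is independent of the next pair (waiting time, jump)
      ([history_independent_next]), so conditioning on it amounts to
      integrating the pair out with the history held fixed ([freezing]).
      Repeating this over the next [k] jumps expresses the probability of
      landing in [B] after exactly [k] more jumps by the finitely iterated
      integrals [landing] and [landing_prob] ([renewal]).
    - The memoryless property of the first remaining waiting time
      ([landing_memoryless]) replaces the clock started at the last jump by a
      clock started at [t] ([markov_epoch]).
    Summing over [k] and [m] is legitimate because the waiting times almost
    surely do not accumulate ([no_explosion]).  The result is
    [markov_identity]: for [A] in the natural filtration at [t],
    [P (A & X (t + h) in B)] is the integral over [A] of the transition
    function at [(h, X t, B)].  This integrand is measurable for the state at
    [t] alone, so it is a version of both conditional probabilities in the
    theorem; with the whole space for [A] and a constant initial state the
    identity is the Chapman-Kolmogorov equation.  Measurability of everything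
    involved rests on joint continuity of the semigroup in time and space and
    on separability of [V]. *)

Local Open Scope classical_set_scope.
Local Open Scope ring_scope.

(** * Measurability in separable spaces *)

Lemma separable_second_countable (R : realType) (V : pseudoMetricType R) :
  separable V -> @second_countable V.
Proof.
move=> [D [cD dD]].
exists [set U | exists2 p : V * nat, D p.1 & U = interior (ball p.1 p.2.+1%:R^-1)].
  apply: (@sub_countable _ _ _ (D `*` [set: nat])); last exact: countableX.
  apply: card_le_trans (card_image_le
    (fun p : V * nat => interior (ball p.1 (p.2.+1%:R^-1 : R))) _).
  by apply: subset_card_le => U [p Dp ->]; exists p.
split=> [U [p _ ->]|v A]; first exact: open_interior.
rewrite -nbhs_ballE => -[e /= e0 veA].
(* The radius is such that the ball around [u] contains [v] with a margin and
   still lies in the ball of radius [e] around [v]. *)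
have [n ne] : exists n : nat, n.+1%:R^-1 < e / 2.
  have e20 : 0 < e / 2 by rewrite divr_gt0.
  exists (Num.truncn (e / 2)^-1); rewrite invf_plt ?posrE//.
  exact: truncnS_gt.
have r0 : 0 < n.+1%:R^-1 / 2 :> R by rewrite divr_gt0 ?invr_gt0.
have [u [/= uv Du]] : (interior (ball v (n.+1%:R^-1 / 2)) `&` D) !=set0.
  by apply: dD; [exists v; exact: nbhsx_ballx|exact: open_interior].
have vu : ball v (n.+1%:R^-1 / 2) u by exact: interior_subset uv.
exists (interior (ball u n.+1%:R^-1)) => /=.
  split; first by exists (u, n).
  rewrite /interior -nbhs_ballE; exists (n.+1%:R^-1 / 2) => //= w vw.
  by apply: (@ball_splitr _ _ v) => //; exact: ball_sym.
move=> w /interior_subset uw; apply: veA.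
apply: (@ball_split _ _ u).
  by apply: le_ball vu; rewrite (le_trans _ (ltW ne))// ler_piMr// invf_le1// ler1n.
by apply: le_ball uw; exact: ltW.
Qed.

(** The Borel sigma-algebra of a product is generated by rectangles only under
    second countability: then an open set is a countable union of open
    rectangles, so continuous functions of two measurable maps are
    measurable. *)
Lemma measurable_continuous_pair d (Om : measurableType d)
    (X Y Z : topologicalType) (F : X * Y -> Z) (f : Om -> X) (g : Om -> Y) :
  @second_countable X -> @second_countable Y -> continuous F ->
  (forall U, open U -> measurable (f @^-1` U)) ->
  (forall U, open U -> measurable (g @^-1` U)) ->
  forall U, open U -> measurable ((fun w => F (f w, g w)) @^-1` U).
Proof.
move=> [BX cX [oX bX]] [BY cY [oY bY]] /continuousP cF mf mg U oU.
pose I := [set p : set X * set Y | [/\ BX p.1, BY p.2 & p.1 `*` p.2 `<=` F @^-1` U]].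
have -> : (fun w => F (f w, g w)) @^-1` U =
    \bigcup_(p in I) (f @^-1` p.1 `&` g @^-1` p.2).
  apply/seteqP; split=> [w Uw|w [p [_ _ pU] [fp gp]]]; last exact: (pU (_, _)).
  have : nbhs (f w, g w) (F @^-1` U).
    by apply: open_nbhs_nbhs; split => //; exact: cF.
  move=> [[/= A B] [nA nB] ABU].
  have [A' [BA' A'w] A'A] := bX _ _ nA.
  have [B' [BB' B'w] B'B] := bY _ _ nB.
  exists (A', B') => //; split => //= -[a b] [/= aA bB]; apply: ABU.
  by split; [exact: A'A|exact: B'B].
have cI : countable I.
  apply: (@sub_countable _ _ _ (BX `*` BY)); last exact: countableX.
  by apply: subset_card_le => p [].
rewrite bigcup_set_type; apply: countable_bigcupT_measurable.
  by rewrite (eq_countable (card_setT _)).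
move=> [p Ip]; move: (Ip) => /set_mem[BXp BYp _] /=.
by apply: measurableI; [apply: mf; exact: oX|apply: mg; exact: oY].
Qed.

Lemma second_countable_real (R : realType) : @second_countable R.
Proof.
apply: separable_second_countable; exists (range ratr); split; last exact: dense_rat.
apply: sub_countable (card_image_le _ _) _; exact: countableP.
Qed.

Lemma measurable_fun_borel d (Om : measurableType d) (V : ptopologicalType)
    (f : Om -> borel V) :
  (forall U : set V, open U -> measurable (f @^-1` U)) -> measurable_fun setT f.
Proof.
move=> mf; apply: (measurability (@open V : set (set (borel V)))) => //.
by move=> _ [U oU <-]; rewrite setTI; exact: mf.
Qed.

Lemma borel_preimage d (Om : measurableType d) (V : ptopologicalType)
    (f : Om -> borel V) : measurable_fun setT f ->
  forall U : set V, open U -> measurable (f @^-1` U).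
Proof.
move=> mf U oU; rewrite -[_ @^-1` _]setTI; apply: mf => //.
exact: sub_sigma_algebra.
Qed.

Section clamped_semigroup.
Context {R : realType} {V : completeNormedModType R}.
Variable T : R -> V -> V.

(** The semigroup is only constrained at nonnegative times; clamping the time at
    [0] gives a total map, continuous on all of [R] and equal to [T] wherever the
    process evaluates it. *)
Definition Tplus (t : R) (v : V) : V := T (Num.max t 0) v.

Hypotheses (T_semigroup : semigroup T) (T_continuous : time_continuous T)
  (T_contractive : contractive T).

Lemma TplusE t v : 0 <= t -> Tplus t v = T t v.
Proof. by move=> t0; rewrite /Tplus max_l. Qed.

Lemma TplusD s t v : 0 <= s -> 0 <= t -> Tplus (s + t) v = Tplus s (Tplus t v).
Proof.
by move=> s0 t0; rewrite !TplusE ?addr_ge0//; apply: T_semigroup.2.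
Qed.

Lemma Tplus0 v : Tplus 0 v = v.
Proof. by rewrite TplusE// T_semigroup.1. Qed.

Lemma continuous_Tplus_time v : continuous (Tplus ^~ v).
Proof.
move=> t U /= UT.
have /subspace_continuousP Tc := @T_continuous v.
have m0 : `[0, +oo[%classic (Num.max t 0) by rewrite /= in_itv/= andbT le_max lexx orbT.
have Um := Tc _ m0 U UT.
have : {for t, continuous (@id R^o \max (@cst R R^o 0))}.
  by apply: (@continuous_max R R^o) => //; exact: cst_continuous.
move=> H; apply: (@filterS _ (nbhs t) _ _ _ _ (H _ Um)) => s /=; apply.
by rewrite /= in_itv/= andbT le_max lexx orbT.
Qed.

(** Contractivity makes the maps equicontinuous in space, which upgrades
    continuity in time at each fixed point to joint continuity. *)
Lemma continuous_Tplus : continuous (fun p : R * V => Tplus p.1 p.2).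
Proof.
move=> -[t v]; apply/cvgrPdist_lt => /= e e0.
have e20 : 0 < e / 2 by rewrite divr_gt0.
have /cvgrPdist_lt/(_ _ e20) At := @continuous_Tplus_time v t.
have Av : \forall u \near v, `|v - u| < e / 2.
  have /cvgrPdist_lt := @cvg_id _ (nbhs v); exact.
exists ([set s | `|Tplus t v - Tplus s v| < e / 2], [set u | `|v - u| < e / 2]) => //=.
move=> [s u] /= [st uv].
rewrite [ltRHS](splitr e) (le_lt_trans (ler_distD (Tplus s v) _ _))// ltrD//.
by apply: le_lt_trans uv; apply: T_contractive; rewrite le_max lexx orbT.
Qed.
End clamped_semigroup.

Section measurable_operations.
Context {R : realType} {V : completeNormedModType R}.
Hypothesis V_separable : separable V.
Context {d} {Om : measurableType d}.

Lemma measurable_fun_Tplus (T : R -> V -> V) (a : Om -> R) (y : Om -> borel V) :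
  time_continuous T -> contractive T ->
  measurable_fun setT a -> measurable_fun setT y ->
  measurable_fun setT (fun w => Tplus T (a w) (y w) : borel V).
Proof.
move=> Tc Tn ma my; apply: measurable_fun_borel => U oU.
apply: (measurable_continuous_pair (second_countable_real R)
  (separable_second_countable V_separable) (continuous_Tplus Tc Tn)) => //.
- move=> W oW; rewrite -[_ @^-1` _]setTI; apply: ma => //.
  exact: open_measurable.
- exact: borel_preimage.
Qed.

Lemma measurable_fun_borelD (y z : Om -> borel V) :
  measurable_fun setT y -> measurable_fun setT z ->
  measurable_fun setT (fun w => (y w : V) + (z w : V) : borel V).
Proof.
move=> my mz; apply: measurable_fun_borel => U oU.
have V2 := separable_second_countable V_separable.
apply: (measurable_continuous_pair V2 V2 (F := fun p : V * V => p.1 + p.2)) => //.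
- exact: add_continuous.
- exact: borel_preimage.
- exact: borel_preimage.
Qed.

End measurable_operations.

(** * Integrating out an independent variable *)

Section freezing.
Local Open Scope ereal_scope.
Context {R : realType}.

Lemma eq_measure_rectangles {d1 d2} {T1 : measurableType d1} {T2 : measurableType d2}
    (m1 m2 : {measure set (T1 * T2) -> \bar R}) :
  m1 setT < +oo ->
  (forall A B, measurable A -> measurable B -> m1 (A `*` B) = m2 (A `*` B)) ->
  forall C, measurable C -> m1 C = m2 C.
Proof.
move=> m1fin m12.
apply: (@measure_unique _ _ _
  [set A `*` B | A in measurable & B in measurable] (fun=> setT)) => //.
- exact: measurable_prod_measurableType.
- move=> _ _ [A mA [B mB <-]] [A' mA' [B' mB' <-]]; rewrite -setXI.
  by exists (A `&` A'); [exact: measurableI|exists (B `&` B') => //; exact: measurableI].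
- by move=> _; exists setT => //; exists setT => //; rewrite setXTT.
- by rewrite bigcup_const//; exists 0%N.
- by move=> _ [A mA [B mB <-]]; exact: m12.
Qed.

Context {d d'} {Om : measurableType d} {E : measurableType d'}.
Variables (P : probability Om R) (G : set (set Om)) (k : Om -> E)
  (nu : probability E R).
Hypotheses (Gm : G `<=` measurable) (mk : measurable_fun setT k).
Hypothesis indep : forall A D, <<s G >> A -> measurable D ->
  P (A `&` k @^-1` D) = P A * nu D.

Let OG := g_sigma_algebraType G.

Lemma measurable_idG : measurable_fun setT (idfun : Om -> OG).
Proof.
move=> _ A; rewrite setTI => GA.
exact: (smallest_sub (@sigma_algebra_measurable _ Om) Gm).
Qed.

(** The law of the pair (sample point seen through [G], [k]) is a product measure
    by independence, so this is Tonelli.  Keeping the sample point itself as the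
    first coordinate avoids naming the [G]-measurable quantities on which [f]
    depends. *)
Lemma freezing_setT (f : OG * E -> \bar R) :
  measurable_fun setT f -> (forall p, 0 <= f p) ->
  \int[P]_w f (w, k w) = \int[P]_w \int[nu]_y f (w, y).
Proof.
move=> mf f0.
pose idG : {mfun Om >-> OG} := HB.pack (idfun : Om -> OG)
  (isMeasurableFun.Build _ _ _ _ _ measurable_idG).
pose PG : probability OG R := distribution P idG.
have mpair : measurable_fun setT (fun w : Om => (idG w, k w)).
  exact: measurable_fun_pair.
pose pair : {mfun Om >-> (OG * E)%type} := HB.pack (fun w : Om => (idG w, k w))
  (isMeasurableFun.Build _ _ _ _ _ mpair).
pose PE : probability (OG * E)%type R := distribution P pair.
rewrite -[LHS](@ge0_integral_distribution _ _ _ _ _ P pair)//.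
rewrite (eq_measure_integral (PG \x nu)); last first.
  move=> C mC _; apply: (@eq_measure_rectangles _ _ _ _ PE (PG \x nu)) => //.
    exact: (le_lt_trans (@probability_le1 _ _ _ PE setT measurableT) (ltry 1)).
  move=> A B mA mB; rewrite [RHS]product_measure1E//.
  exact: indep.
rewrite fubini_tonelli1//.
rewrite (@ge0_integral_distribution _ _ _ _ _ P idG)//.
  exact: measurable_fun_fubini_tonelli_F.
by move=> w; apply: integral_ge0.
Qed.

Lemma freezing (A : set Om) (f : OG * E -> \bar R) : <<s G >> A ->
  measurable_fun setT f -> (forall p, 0 <= f p) ->
  \int[P]_(w in A) f (w, k w) = \int[P]_(w in A) \int[nu]_y f (w, y).
Proof.
move=> GA mf f0.
pose f' := f \_ (A `*` setT).
rewrite integral_mkcond [RHS]integral_mkcond.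
transitivity (\int[P]_w f' (w, k w)).
  apply: eq_integral => w _; rewrite /f' !patchE.
  have [wA|wA] := boolP (w \in A); first by rewrite in_setX wA in_setT.
  by rewrite in_setX (negbTE wA).
rewrite freezing_setT//.
- apply: eq_integral => w _; rewrite /f' !patchE.
  have [wA|wA] := boolP (w \in A).
    by apply: eq_integral => y _; rewrite patchE in_setX wA in_setT.
  rewrite -[RHS](@integral0 _ _ _ nu setT).
  by apply: eq_integral => y _; rewrite patchE in_setX (negbTE wA).
- apply/(measurable_restrict _ _ _) => //; first exact: measurableX.
  exact: measurable_funTS.
- by move=> p; rewrite /f' patchE; case: ifP.
Qed.

End freezing.

(** * Absence of memory of the exponential law *)

Lemma ge0_integral_mrestr {R : realType} {d} {T : measurableType d}
    (mu : {measure set T -> \bar R}) (D : set T) (mD : measurable D)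
    (f : T -> \bar R) : measurable_fun setT f -> (forall x, (0 <= f x)%E) ->
  (\int[mrestr mu mD]_x f x = \int[mu]_(x in D) f x)%E.
Proof.
move=> mf f0.
rewrite (@ge0_negligible_integral _ _ _ _ setT (~` D))//; last 2 first.
  exact: measurableC.
  by rewrite -[LHS]/(mu (~` D `&` D)) setICl measure0.
rewrite setTD setCK.
by apply: eq_measure_integral => A mA AD; rewrite -[RHS](congr1 mu (setIidl AD)).
Qed.

(** The memoryless property in integrated form says that the image under a shift
    of a restricted measure is a multiple of the measure itself; it suffices to
    compare the two on rectangles. *)
Section scaled_image.
Local Open Scope ereal_scope.
Context {R : realType} {d d1 d2} {T : measurableType d} {T1 : measurableType d1}
  {T2 : measurableType d2}.
Variables (m : {finite_measure set T -> \bar R})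
  (m' : {measure set (T1 * T2) -> \bar R}) (phi : T -> T1 * T2) (D : set T) (c : {nonneg R}).
Hypotheses (mphi : measurable_fun setT phi) (mD : measurable D).
Hypothesis scaled : forall A B, measurable A -> measurable B ->
  m (phi @^-1` (A `*` B) `&` D) = c%:num%:E * m' (A `*` B).

Lemma ge0_integral_scaled_image (f : T1 * T2 -> \bar R) :
  measurable_fun setT f -> (forall z, 0 <= f z) ->
  \int[m]_(z in D) f (phi z) = c%:num%:E * \int[m']_z f z.
Proof.
move=> mf f0.
pose m1' : {measure set (T1 * T2) -> \bar R} := pushforward (mrestr m mD) phi.
pose m1 := m1' mphi.
have mfphi : measurable_fun setT (f \o phi) by exact: measurableT_comp.
have E1 := @ge0_integral_pushforward _ _ _ _ R _ mphi (mrestr m mD) setT f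
  measurableT mf (fun z _ => f0 z).
have E2 := ge0_integral_mrestr m mD mfphi (fun z => f0 _).
apply: (etrans (esym E2)); apply: (etrans (esym E1)).
rewrite -(ge0_integral_mscale m' measurableT c mf (fun z _ => f0 z)).
apply: (eq_measure_integral (mscale c m')) => C mC _.
apply: (eq_measure_rectangles (m1 := m1)) => //.
rewrite -[ltLHS]/(m (setT `&` D)) setTI.
by rewrite -ge0_fin_numE// fin_num_measure.
Qed.

End scaled_image.

Section memoryless.
Local Open Scope ereal_scope.
Context {R : realType}.
Variables (theta : R) (lam : probability R R).
Hypothesis lam_tail : forall x : R, (0 <= x)%R ->
  lam `]x, +oo[%classic = (expR (- theta * x))%:E.

Lemma memoryless_tail (s h : R) : (0 <= s)%R -> (0 <= h)%R ->
  lam `](s + h)%R, +oo[%classic = lam `]s, +oo[%classic * lam `]h, +oo[%classic.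
Proof.
move=> s0 h0; rewrite !lam_tail ?addr_ge0//.
by rewrite -EFinM -expRD mulrDr.
Qed.

Lemma lam_support : lam `]0%R, +oo[%classic = 1.
Proof. by rewrite lam_tail// mulr0 expR0. Qed.

(** The law charges only positive numbers, so the tail at a negative point is the
    tail at [0]. *)
Lemma lam_tail_max (x : R) : lam `]x, +oo[%classic = lam `](Num.max x 0)%R, +oo[%classic.
Proof.
have [x0|x0] := leP 0%R x; first by [].
apply/eqP; rewrite eq_le; apply/andP; split; last first.
  by apply: le_measure; rewrite ?inE// => y; rewrite /= !in_itv/= !andbT; exact: lt_trans.
by rewrite lam_support probability_le1.
Qed.

(** Half-lines generate the Borel sets, so the identity for tails extends. *)
Lemma memoryless_measure (s : R) (B : set R) : (0 <= s)%R -> measurable B ->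
  lam ((fun b => (b - s)%R) @^-1` B `&` `]s, +oo[%classic) =
  lam `]s, +oo[%classic * lam B.
Proof.
move=> s0 mB.
have mD : measurable `]s, +oo[%classic by [].
have mshift : measurable_fun setT (fun b : R => (b - s)%R) by exact: measurable_funB.
pose m1' : {measure set R -> \bar R} := pushforward (mrestr lam mD) (fun b => (b - s)%R).
pose m1 := m1' mshift.
have c0 : (0 <= fine (lam `]s, +oo[%classic))%R by exact: fine_ge0.
pose m2 : {measure set R -> \bar R} := mscale (NngNum c0) lam.
have cE : lam `]s, +oo[%classic = (fine (lam `]s, +oo[%classic))%:E.
  by rewrite fineK// fin_num_measure.
suff h : m1 B = m2 B by rewrite cE; exact: h.
apply: (@measure_unique _ _ _ (@RGenOInfty.G R)
  (fun n => `](- n%:R)%R, +oo[%classic)) => //.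
- exact: RGenOInfty.measurableE.
- move=> _ _ [x ->] [y ->]; exists (Num.max x y).
  by apply/seteqP; split => z /=; rewrite !in_itv/= !andbT gt_max => /andP.
- by move=> n; exists (- n%:R)%R.
- apply/seteqP; split => // x _; exists (Num.truncn (- x)).+1 => //=.
  by rewrite in_itv/= andbT ltrNl truncnS_gt.
- move=> _ [x ->].
  rewrite -[RHS]/((fine (lam `]s, +oo[%classic))%:E *
    lam `]x, +oo[%classic) -cE.
  rewrite [in RHS](lam_tail_max x) -memoryless_tail//; last by rewrite le_max lexx orbT.
  congr (lam _); apply/seteqP; split => b /=; rewrite !in_itv/= !andbT.
    by move=> [xb sb]; have [] := leP 0%R x; lra.
  by have [] := leP 0%R x => ? ?; split; lra.
- move=> n; apply: (@le_lt_trans _ _ 1); last exact: ltry.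
  rewrite -[leLHS]/(lam ((fun b => (b - s)%R) @^-1` `](- n%:R)%R, +oo[ `&` `]s, +oo[)).
  apply: probability_le1; apply: measurableI => //.
  by rewrite -[X in measurable X]setTI; exact: measurable_funB.
Qed.

Context {d} {E : measurableType d} (mu : probability E R).

Lemma tail_strip (s : R) : [set z : R * E | (s < z.1)%R] = `]s, +oo[ `*` setT.
Proof. by apply/seteqP; split => z /=; rewrite in_itv/= andbT => // -[]. Qed.

Lemma measurable_tail_strip (s : R) : measurable [set z : R * E | (s < z.1)%R].
Proof. by rewrite tail_strip; exact: measurableX. Qed.

Lemma product_measure_tail_strip (s : R) :
  (lam \x mu) [set z | (s < z.1)%R] = lam `]s, +oo[%classic.
Proof.
by rewrite tail_strip product_measure1E// [X in _ * X]probability_setT mule1.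
Qed.

Lemma memoryless_integral (s : R) (f : R * E -> \bar R) : (0 <= s)%R ->
  measurable_fun setT f -> (forall z, 0 <= f z) ->
  \int[lam \x mu]_(z in [set z | (s < z.1)%R]) f ((z.1 - s)%R, z.2) =
  lam `]s, +oo[%classic * \int[lam \x mu]_z f z.
Proof.
move=> s0 mf f0.
have mD := measurable_tail_strip s.
have mshift : measurable_fun setT (fun z : R * E => ((z.1 - s)%R, z.2)).
  by apply: measurable_fun_pair => //; exact: measurable_funB.
have c0 : (0 <= fine (lam `]s, +oo[%classic))%R by exact: fine_ge0.
have cE : lam `]s, +oo[%classic = (NngNum c0)%:num%:E.
  by rewrite fineK// fin_num_measure.
pose nu : probability (R * E)%type R := (lam \x mu).
rewrite cE; apply: (ge0_integral_scaled_image (m := nu) (m' := nu) mshift mD) => // A B mA mB.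
rewrite -cE [X in _ * X]product_measure1E// muleA -memoryless_measure//.
have mA' : measurable ((fun b => (b - s)%R) @^-1` A `&` `]s, +oo[%classic).
  by apply: measurableI => //; rewrite -[X in measurable X]setTI; exact: measurable_funB.
rewrite -[RHS](product_measure1E lam mu mA' mB); congr (nu _).
by apply/seteqP; split => z/=; rewrite in_itv/= andbT; tauto.
Qed.

End memoryless.

(** * The history before a jump is independent of what follows *)

Section history.
Context {R : realType} {d} {Om : measurableType d} {V : completeNormedModType R}.
Variables (P : probability Om R) (eta : nat -> {RV P >-> borel V})
  (beta : nat -> {RV P >-> R}) (x : Om -> borel V).

(** A generating class for the sigma-algebra of the initial state and the first
    [m] waiting times and jumps.  Adding one pair of variables at a time, by
    rectangles over the sigma-algebra already built, makes every class stable
    under intersection, so measures agreeing on it agree on what it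
    generates. *)
Fixpoint history (m : nat) : set (set Om) :=
  if m is m'.+1 then
    [set D | exists A B C, [/\ <<s history m' >> A, measurable B, measurable C &
      D = A `&` (beta m' @^-1` B `&` eta m' @^-1` C)]]
  else g_sigma_algebra_preimage x.

Hypothesis mx : measurable_fun setT x.

Lemma measurable_beta_preimage m B : measurable B -> measurable (beta m @^-1` B).
Proof. by move=> mB; exact: measurable_funPTI. Qed.

Lemma measurable_eta_preimage m C : measurable C -> measurable (eta m @^-1` C).
Proof. by move=> mC; exact: measurable_funPTI. Qed.

Lemma history_measurable m : history m `<=` measurable.
Proof.
elim: m => [_ [B mB <-]|m IH _ [A [B [C [hA mB mC ->]]]]]; first exact: mx.
apply: measurableI; first exact: (smallest_sub (@sigma_algebra_measurable _ Om) IH).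
by apply: measurableI; [exact: measurable_beta_preimage|exact: measurable_eta_preimage].
Qed.

Lemma gen_history_measurable m : <<s history m >> `<=` measurable.
Proof. exact: smallest_sub (@sigma_algebra_measurable _ Om) (@history_measurable m). Qed.

Lemma gen_historyS m A : <<s history m >> A -> <<s history m.+1 >> A.
Proof.
move=> hA; apply: sub_sigma_algebra; exists A, setT, setT; split => //.
by rewrite !preimage_setT !setIT.
Qed.

Lemma gen_history_le m n : (m <= n)%N -> <<s history m >> `<=` <<s history n >>.
Proof.
move=> /subnK <-; elim: (n - m)%N => [//|k IH] A /IH hA.
by rewrite addSn; exact: gen_historyS.
Qed.

Lemma setI_closed_history m : setI_closed (history m).
Proof.
case: m => [|m] /=.
  move=> _ _ [A mA <-] [B mB <-]; exists (A `&` B); first exact: measurableI.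
  by rewrite !setTI preimage_setI.
move=> _ _ [A [B [C [hA mB mC ->]]]] [A' [B' [C' [hA' mB' mC' ->]]]].
exists (A `&` A'), (B `&` B'), (C `&` C'); split.
- exact: (@measurableI _ (g_sigma_algebraType (history m))).
- exact: measurableI.
- exact: measurableI.
- by rewrite !preimage_setI; apply/seteqP; split => w /=; tauto.
Qed.

Lemma history_setT m : history m setT.
Proof.
case: m => [|m] /=; first by exists setT => //; rewrite setTI.
exists setT, setT, setT; split => //; last by rewrite !preimage_setT !setIT.
exact: (@measurableT _ (g_sigma_algebraType (history m))).
Qed.

Hypotheses (eta_iid : iid P eta) (beta_iid : iid P beta).
Hypothesis eta_beta_indep :
  independent_algebras P (sigma_gen setT eta) (sigma_gen setT beta).
Hypothesis x_indep : independent_initial P eta beta x.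

Definition cylinder (m j : nat) (B : nat -> set R) (C : nat -> set (borel V)) : set Om :=
  [set w | forall i, (i < j)%N -> B i (beta (m + i)%N w) /\ C i (eta (m + i)%N w)].

Lemma cylinderS m j B C : cylinder m j.+1 B C =
  (beta m @^-1` B 0%N `&` eta m @^-1` C 0%N) `&`
  cylinder m.+1 j (fun i => B i.+1) (fun i => C i.+1).
Proof.
apply/seteqP; split => w.
  move=> h; split; first by have := h 0%N isT; rewrite addn0.
  by move=> i ij; have := h i.+1 ij; rewrite addnS -addSn.
move=> [h0 h] [|i] ij; first by rewrite addn0.
by have := h i ij; rewrite addSn -addnS.
Qed.

Lemma cylinder0 m B C : cylinder m 0 B C = setT.
Proof. by apply/seteqP; split => // w _ i. Qed.

Lemma measurable_cylinder m j B C : (forall i, measurable (B i)) ->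
  (forall i, measurable (C i)) -> measurable (cylinder m j B C).
Proof.
elim: j m B C => [|j IH] m B C mB mC; first by rewrite cylinder0.
rewrite cylinderS; apply: measurableI; last exact: IH.
by apply: measurableI; [exact: measurable_beta_preimage|exact: measurable_eta_preimage].
Qed.

Let lam := distribution P (beta 0%N).
Let mu := distribution P (eta 0%N).

Lemma probability_cylinder0 j B C : (forall i, measurable (B i)) ->
  (forall i, measurable (C i)) ->
  P (cylinder 0 j B C) = (\prod_(i < j) (lam (B i) * mu (C i)))%E /\
  <<s sigma_gen setT eta `|` sigma_gen setT beta >> (cylinder 0 j B C).
Proof.
move=> mB mC.
pose Db := \bigcap_(i in [set` iota 0 j]) beta i @^-1` B i.
pose De := \bigcap_(i in [set` iota 0 j]) eta i @^-1` C i.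
have sb : sigma_gen setT beta Db.
  apply: (@fin_bigcap_measurable _ (g_sigma_algebraType
    (\bigcup_(i in setT) g_sigma_algebra_preimage (beta i)))) => //.
  move=> i _; apply: sub_sigma_algebra; exists i => //.
  by exists (B i) => //; rewrite setTI.
have se : sigma_gen setT eta De.
  apply: (@fin_bigcap_measurable _ (g_sigma_algebraType
    (\bigcup_(i in setT) g_sigma_algebra_preimage (eta i)))) => //.
  move=> i _; apply: sub_sigma_algebra; exists i => //.
  by exists (C i) => //; rewrite setTI.
have -> : cylinder 0 j B C = De `&` Db.
  apply/seteqP; split => w.
    by move=> h; split => i /=; rewrite mem_iota => /andP[_ ij]; apply (h i ij).
  by move=> [he hb] i ij; split; [apply: hb|apply: he]; rewrite /= mem_iota.
split.
  rewrite eta_beta_indep// /De /Db eta_iid.1 ?iota_uniq// beta_iid.1 ?iota_uniq//.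
  rewrite (_ : iota 0 j = index_iota 0 j) ?[in RHS]/index_iota ?subn0//.
  rewrite !big_mkord -big_split/=; apply: eq_bigr => i _.
  rewrite muleC /lam /mu /distribution /pushforward.
  by rewrite (beta_iid.2 i 0%N)// (eta_iid.2 i 0%N).
apply: (@measurableI _ (g_sigma_algebraType
  (sigma_gen setT eta `|` sigma_gen setT beta))); apply: sub_sigma_algebra.
  by left.
by right.
Qed.

Lemma prod_probability_fin j (B : nat -> set R) (C : nat -> set (borel V)) :
  (forall i, measurable (B i)) ->  (forall i, measurable (C i)) ->
  (\prod_(i < j) (lam (B i) * mu (C i)))%E \is a fin_num /\
  (0 <= \prod_(i < j) (lam (B i) * mu (C i)))%E.
Proof.
move=> mB mC; elim/big_ind : _ => [//|a b [? ?] [? ?]|i _].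
  by split; [exact: fin_numM|exact: mule_ge0].
by split; [apply: fin_numM; exact: fin_num_measure|exact: mule_ge0].
Qed.

(** Induction on [m].  A generator of the next history is an event of the previous
    one intersected with an event on pair number [m]; together with a cylinder
    from [m.+1] on it forms an event of the previous history intersected with a
    longer cylinder from [m] on, to which the induction hypothesis applies. *)
Lemma history_independent_future m A j B C : <<s history m >> A ->
  (forall i, measurable (B i)) ->  (forall i, measurable (C i)) ->
  P (A `&` cylinder m j B C) = (P A * \prod_(i < j) (lam (B i) * mu (C i)))%E.
Proof.
elim: m A j B C => [|m IH] A j B C hA mB mC.
  have [<- scyl] := probability_cylinder0 j mB mC; apply: x_indep => //.
  have <- : <<s g_sigma_algebra_preimage x >> = g_sigma_algebra_preimage x.
    exact: (sigma_algebra_id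
      (sigma_algebra_measurable (g_sigma_algebra_preimageType x))).
  exact: hA.
have [pfin p0] := prod_probability_fin j mB mC.
have pE : (\prod_(i < j) (lam (B i) * mu (C i)))%E =
  (fine (\prod_(i < j) (lam (B i) * mu (C i)))%E)%:E by rewrite fineK.
have c0 : (0 <= fine (\prod_(i < j) (lam (B i) * mu (C i)))%E) by exact: fine_ge0.
have mcyl := measurable_cylinder m.+1 j mB mC.
pose m2 : {measure set Om -> \bar R} := mscale (NngNum c0) P.
rewrite muleC pE -[RHS]/(m2 A).
apply: (@g_sigma_algebra_measure_unique _ _ _ (history m.+1) _ (fun=> setT) _ _
  (mrestr P mcyl)) => //.
- exact: history_measurable.
- by move=> _; exact: history_setT.
- by rewrite bigcup_const//; exists 0%N.
- exact: setI_closed_history.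
- move=> _ [A' [b [c [hA' mb mc ->]]]].
  rewrite -[RHS]/((fine (\prod_(i < j) (lam (B i) * mu (C i)))%E)%:E * P _)%E -pE.
  rewrite -[LHS]/(P (_ `&` _)).
  (* The longer cylinder, with the new pair in front. *)
  pose B' i := if i is i'.+1 then B i' else b.
  pose C' i := if i is i'.+1 then C i' else c.
  have mB' i : measurable (B' i) by case: i.
  have mC' i : measurable (C' i) by case: i.
  have := IH A' j.+1 B' C' hA' mB' mC'.
  rewrite cylinderS setIA => ->.
  have := IH A' 1%N B' C' hA' mB' mC'.
  rewrite cylinderS cylinder0 setIT => ->.
  by rewrite big_ord1 big_ord_recl/= muleA muleC.
- move=> _; rewrite -[ltLHS]/(P (setT `&` cylinder m.+1 j B C)).
  by rewrite (le_lt_trans (probability_le1 _ _)) ?ltry// setTI.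
Qed.

Lemma history_independent_next m A (D : set (R * borel V)) : <<s history m >> A ->
  measurable D ->
  P (A `&` (fun w => (beta m w, eta m w)) @^-1` D) = (P A * (lam \x mu)%E D)%E.
Proof.
move=> hA mD.
have mA := gen_history_measurable hA.
have mpair : measurable_fun setT (fun w => (beta m w, eta m w) : R * borel V).
  exact: measurable_fun_pair.
have pE : P A = (fine (P A))%:E by rewrite fineK// fin_num_measure.
have c0 : 0 <= fine (P A) by exact: fine_ge0.
pose m2 : {measure set (R * borel V) -> \bar R} := mscale (NngNum c0) (lam \x mu)%E.
pose m1' : {measure set (R * borel V) -> \bar R} :=
  pushforward (mrestr P mA) (fun w => (beta m w, eta m w) : R * borel V).
pose m1 := m1' mpair.
rewrite pE setIC -[LHS]/(m1 D) -[RHS]/(m2 D).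
apply: eq_measure_rectangles => //.
  rewrite -[ltLHS]/(P (setT `&` A)).
  by rewrite (le_lt_trans (probability_le1 _ _)) ?ltry// setTI.
move=> B C mB mC.
rewrite -[RHS]/((fine (P A))%:E * (lam \x mu) (B `*` C))%E -pE product_measure1E//.
have := @history_independent_future m A 1%N (fun=> B) (fun=> C) hA (fun=> mB) (fun=> mC).
by rewrite cylinderS cylinder0 setIT big_ord1 setIC => <-.
Qed.

End history.

(** * The piecewise deterministic path *)

Section epochs.
Context {R : realType} {d} {Om : measurableType d} {V : completeNormedModType R}.
Variables (T : R -> V -> V) (eta : nat -> Om -> borel V) (beta : nat -> Om -> R)
  (x : Om -> borel V).
Hypothesis beta_gt0 : forall m w, 0 < beta m w.

Definition epoch (m : nat) (t : R) : set Om :=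
  [set w | arrival beta m w <= t < arrival beta m.+1 w].

Lemma arrival0 w : arrival beta 0 w = 0.
Proof. by rewrite /arrival big_ord0. Qed.

Lemma arrivalS m w : arrival beta m.+1 w = arrival beta m w + beta m w.
Proof. by rewrite /arrival big_ord_recr. Qed.

Lemma arrival_lt m n w : (m < n)%N -> arrival beta m w < arrival beta n w.
Proof.
elim: n => // n IH; rewrite ltnS leq_eqVlt => /orP[/eqP->|/IH mn].
  by rewrite arrivalS ltrDl.
by rewrite (lt_trans mn)// arrivalS ltrDl.
Qed.

Lemma arrival_le m n w : (m <= n)%N -> arrival beta m w <= arrival beta n w.
Proof.
by rewrite leq_eqVlt => /orP[/eqP->//|/arrival_lt mn]; exact: ltW.
Qed.

Lemma arrival_ge0 m w : 0 <= arrival beta m w.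
Proof. by rewrite -(arrival0 w) arrival_le. Qed.

Lemma epoch_inj m n s t w : s <= t -> epoch m t w -> epoch n s w -> (n <= m)%N.
Proof.
move=> st /andP[mt tm] /andP[ns sn]; rewrite leqNgt; apply/negP => /arrival_le.
move=> /(_ w); lra.
Qed.

Lemma trivIset_epoch t : trivIset setT (epoch ^~ t).
Proof.
move=> m n _ _ [w [mw nw]]; apply/eqP; rewrite eqn_leq.
by rewrite (epoch_inj _ mw nw)// (epoch_inj _ nw mw).
Qed.

(** The first alternative is explosion: all jumps occur up to time [t]. *)
Lemma epoch_from m t w : arrival beta m w <= t ->
  (forall n, arrival beta n w <= t) \/ exists k, epoch (m + k) t w.
Proof.
move=> mt.
have [h|h] := pselect (exists k, t < arrival beta (m + k).+1 w); last first.
  left => n; rewrite leNgt; apply/negP => tn; apply: h; exists n.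
  by rewrite (lt_le_trans tn)// arrival_le// (leq_trans (leq_addl m n)).
right; pose k := ex_minn h; exists k; rewrite /k; case: ex_minnP => -[|j] tj jmin.
  by rewrite /epoch/= addn0 mt; rewrite addn0 in tj.
rewrite /epoch/= tj andbT leNgt; apply/negP; rewrite addnS => tj'.
by have := jmin _ tj'; rewrite ltnn.
Qed.

Lemma jump_flow_epoch m t w : epoch m t w ->
  jump_flow T eta beta x t w =
  Tplus T (t - arrival beta m w) (jump_chain T eta beta x m w).
Proof.
move=> mt; apply/cvg_lim => //.
apply: cvg_near_cst; exists m.+1 => // n /= mn.
rewrite (bigD1_seq m) ?mem_index_iota ?iota_uniq//= [X in _ + X]big1.
  rewrite addr0 indicE mem_set ?scale1r//= in_itv/=; exact: mt.
move=> i im; rewrite indicE (_ : (t \in _) = false) ?scale0r//.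
apply/negP; rewrite inE/= in_itv/= => it.
by move/eqP: im; apply; apply: (trivIset_epoch (t := t)) => //; exists w.
Qed.

(** After an explosion every term of the series defining the process vanishes. *)
Lemma jump_flow_out t w : (forall m, ~ epoch m t w) -> jump_flow T eta beta x t w = (0 : V).
Proof.
move=> h; apply/cvg_lim => //.
apply: cvg_near_cst; exists 0%N => // n _; rewrite big1// => m _.
rewrite indicE (_ : (t \in _) = false) ?scale0r//; apply/negP; rewrite inE/= in_itv/=.
exact: h.
Qed.

End epochs.

(** * Measurability with respect to the history *)

Section measurable_epoch.
Context {R : realType} {d} {Om : measurableType d}.
Variables (P : probability Om R) (beta : nat -> {RV P >-> R}).

Lemma measurable_arrival m : measurable_fun setT (arrival beta m : Om -> R).
Proof.
elim: m => [|m IH].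
  rewrite (_ : arrival beta 0 = cst 0); first exact: measurable_cst.
  by apply/funext => w; rewrite arrival0.
rewrite (_ : arrival beta m.+1 = arrival beta m \+ beta m); first exact: measurable_funD.
by apply/funext => w; rewrite arrivalS.
Qed.

Lemma measurable_arrived m (t : R) : measurable [set w | arrival beta m w <= t].
Proof.
rewrite -[X in measurable X]setTI.
by apply: measurable_fun_le => //; exact: measurable_arrival.
Qed.

Lemma epochE m (t : R) : epoch beta m t =
  [set w | arrival beta m w <= t] `\` [set w | arrival beta m.+1 w <= t].
Proof.
apply/seteqP; split => w /=; rewrite /epoch/=.
  by move=> /andP[-> h]; split => //; apply/negP; rewrite -ltNge.
by move=> [-> /negP]; rewrite -ltNge.
Qed.

Lemma measurable_epoch m t : measurable (epoch beta m t).
Proof. by rewrite epochE; apply: measurableD; exact: measurable_arrived. Qed.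

End measurable_epoch.

Section history_measurability.
Context {R : realType} {d} {Om : measurableType d} {V : completeNormedModType R}.
Variables (P : probability Om R) (eta : nat -> {RV P >-> borel V})
  (beta : nat -> {RV P >-> R}) (x : Om -> borel V) (T : R -> V -> V).
Hypotheses (V_separable : separable V) (Tc : time_continuous T) (Tn : contractive T).
Hypothesis beta_gt0 : forall m w, 0 < beta m w.

Notation Hm m := (g_sigma_algebraType (history eta beta x m)).

Lemma measurable_history_lift d' (E : measurableType d') m n (f : Om -> E) : (m <= n)%N ->
  measurable_fun setT (f : Hm m -> E) -> measurable_fun setT (f : Hm n -> E).
Proof.
move=> mn mf _ B mB; apply: (gen_history_le mn).
exact: mf.
Qed.

Lemma measurable_history_beta m : measurable_fun setT (beta m : Hm m.+1 -> R).
Proof.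
move=> _ B mB; rewrite setTI; apply: sub_sigma_algebra.
exists setT, B, setT; split => //; last by rewrite preimage_setT setIT setTI.
exact: (@measurableT _ (Hm m)).
Qed.

Lemma measurable_history_eta m : measurable_fun setT (eta m : Hm m.+1 -> borel V).
Proof.
move=> _ C mC; rewrite setTI; apply: sub_sigma_algebra.
exists setT, setT, C; split => //; last by rewrite preimage_setT !setTI.
exact: (@measurableT _ (Hm m)).
Qed.

Lemma measurable_history_arrival m : measurable_fun setT (arrival beta m : Hm m -> R).
Proof.
elim: m => [|m IH].
  rewrite (_ : arrival beta 0 = cst 0); first exact: measurable_cst.
  by apply/funext => w; rewrite arrival0.
rewrite (_ : arrival beta m.+1 = arrival beta m \+ beta m); last first.
  by apply/funext => w; rewrite arrivalS.
apply: (@measurable_funD _ (Hm m.+1)).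
  exact: (measurable_history_lift (leqnSn m)).
exact: measurable_history_beta.
Qed.

Lemma jump_chainS m w : jump_chain T eta beta x m.+1 w =
  Tplus T (beta m w) (jump_chain T eta beta x m w) + (eta m w : V).
Proof. by rewrite /= TplusE// ltW. Qed.

Lemma measurable_history_chain m :
  measurable_fun setT (jump_chain T eta beta x m : Hm m -> borel V).
Proof.
elim: m => [|m IH].
  move=> _ C mC; rewrite setTI; apply: sub_sigma_algebra.
  by exists C => //; rewrite setTI.
rewrite (_ : jump_chain T eta beta x m.+1 = fun w =>
  Tplus T (beta m w) (jump_chain T eta beta x m w) + (eta m w : V)); last first.
  by apply/funext => w; exact: jump_chainS.
apply: (@measurable_fun_borelD _ _ V_separable _ (Hm m.+1)).
  apply: (@measurable_fun_Tplus _ _ V_separable _ (Hm m.+1)) => //.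
    exact: measurable_history_beta.
  exact: (measurable_history_lift (leqnSn m)).
exact: measurable_history_eta.
Qed.

Lemma history_arrived m n (t : R) : (m <= n)%N ->
  <<s history eta beta x n >> [set w | arrival beta m w <= t].
Proof.
move=> mn.
have := @measurable_fun_le _ (Hm n) R setT (arrival beta m) (cst t).
rewrite setTI; apply => //.
exact: (measurable_history_lift mn (@measurable_history_arrival m)).
Qed.

Lemma history_epoch m n (t : R) : (m < n)%N ->
  <<s history eta beta x n >> (epoch beta m t).
Proof.
move=> mn.
rewrite epochE; apply: (@measurableD _ (Hm n)); apply: history_arrived => //.
exact: ltnW.
Qed.

Lemma history_landed m n (t : R) (B : set (borel V)) : (m <= n)%N -> measurable B ->
  <<s history eta beta x n >>
    [set w | B (Tplus T (t - arrival beta m w) (jump_chain T eta beta x m w))].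
Proof.
move=> mn mB.
have : measurable_fun setT ((fun w =>
    Tplus T (t - arrival beta m w) (jump_chain T eta beta x m w)) : Hm n -> borel V).
  apply: (@measurable_fun_Tplus _ _ V_separable _ (Hm n)) => //.
    apply: (@measurable_funB _ (Hm n)); first exact: measurable_cst.
    exact: (measurable_history_lift mn (@measurable_history_arrival m)).
  exact: (measurable_history_lift mn (@measurable_history_chain m)).
by move=> /(_ measurableT _ mB); rewrite setTI.
Qed.

Hypothesis mx : measurable_fun setT x.

Let X := jump_flow T eta beta x.

Lemma preimage_jump_flow t B : X t @^-1` B =
  \bigcup_m (epoch beta m t `&`
    [set w | B (Tplus T (t - arrival beta m w) (jump_chain T eta beta x m w))]) `|`
  ((\bigcap_m ~` epoch beta m t) `&` [set w | B (0 : V)]).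
Proof.
apply/seteqP; split => w /=.
  have [[m mt]|h] := pselect (exists m, epoch beta m t w).
    by rewrite /X (jump_flow_epoch _ _ _ _ mt)// => ?; left; exists m.
  rewrite /X (@jump_flow_out _ _ _ _ T eta beta x)//; last by move=> m mt; apply: h; exists m.
  by move=> B0; right; split => // m _ mt; apply: h; exists m.
case=> [[m _ [mt]]|[h]]; first by rewrite /X (jump_flow_epoch _ _ _ _ mt).
by rewrite /X (@jump_flow_out _ _ _ _ T eta beta x)// => m; exact: h.
Qed.

Lemma measurable_jump_flow t : measurable_fun setT (X t : Om -> borel V).
Proof.
move=> _ B mB; rewrite setTI preimage_jump_flow; apply: measurableU.
  apply: bigcup_measurable => m _; apply: measurableI; first exact: measurable_epoch.
  exact: (gen_history_measurable mx (history_landed _ (leqnn m) mB)).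
apply: measurableI; last first.
  have [B0|B0] := pselect (B 0).
    by rewrite (_ : mkset _ = setT)//; apply/seteqP; split.
  by rewrite (_ : mkset _ = set0)//; apply/seteqP; split.
by apply: bigcap_measurable => // m _; apply: measurableC; exact: measurable_epoch.
Qed.

(** On [epoch m t] the path up to [t] is a function of the initial state and the
    first [m] waiting times and jumps: at a time [s] up to [t] it is in an
    epoch [k < m], or else in the epoch begun at arrival [m], whose end need
    not be known.  Events with this property form a sigma-algebra. *)
Lemma natural_history_trace m (t : R) A : sigma_gen `[0, t] X A ->
  exists2 A', <<s history eta beta x m >> A' &
    A `&` epoch beta m t = A' `&` epoch beta m t.
Proof.
move: A; apply: smallest_sub.
  split.
  - by exists set0 => //; exact: (@measurable0 _ (Hm m)).
  - move=> A [A' hA' AA']; exists (setT `\` A').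
      by apply: (@measurableD _ (Hm m)) => //; exact: (@measurableT _ (Hm m)).
    apply/seteqP; split => w /= [[_ nA] mt]; split => //; split => // Aw; apply: nA.
      by have [] : (A `&` epoch beta m t) w by rewrite AA'.
    by have [] : (A' `&` epoch beta m t) w by rewrite -AA'.
  - move=> F hF.
    pose F' i := sval (cid2 (hF i)).
    have hF' i : <<s history eta beta x m >> (F' i) /\
      F i `&` epoch beta m t = F' i `&` epoch beta m t.
      by rewrite /F'; case: cid2.
    exists (\bigcup_i F' i).
      by apply: (@bigcupT_measurable _ (Hm m)) => i; exact: (hF' i).1.
    by rewrite !setI_bigcupl; apply: eq_bigcupr => i _; exact: (hF' i).2.
move=> A [s /= s0t [B mB <-]].
have {s0t}[s0 st] : 0 <= s /\ s <= t by move: s0t; rewrite in_itv/= => /andP.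
pose landed k := [set w | B (Tplus T (s - arrival beta k w) (jump_chain T eta beta x k w))].
(* In the last term the end of epoch [m] is omitted: it depends on waiting time
   number [m], which is not part of the history. *)
exists ((\bigcup_(k in `I_m) (epoch beta k s `&` landed k)) `|`
   ([set w | arrival beta m w <= s] `&` landed m)).
  apply: (@measurableU _ (Hm m)).
    apply: (@bigcup_measurable _ (Hm m)) => k /= km; apply: (@measurableI _ (Hm m)).
      exact: history_epoch.
    by apply: history_landed => //; exact: ltnW.
  by apply: (@measurableI _ (Hm m)); [exact: history_arrived|exact: history_landed].
rewrite setTI.
have key w : epoch beta m t w -> exists2 k, (k <= m)%N & epoch beta k s w.
  move=> /andP[mt tm].
  have [] := @epoch_from _ _ _ _ beta_gt0 0%N s w; first by rewrite arrival0.
    by move=> /(_ m.+1); lra.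
  move=> [k]; rewrite add0n => ks; exists k => //.
  by apply: (epoch_inj beta_gt0 st _ ks); rewrite /epoch/= mt.
apply/seteqP; split => w /= [h mt]; split => //; have [k km ks] := key _ mt.
- move: h; rewrite /X (jump_flow_epoch _ _ _ _ ks)// => h.
  move: km; rewrite leq_eqVlt => /orP[/eqP km|km]; last by left; exists k.
  by right; rewrite -km; split => //; case/andP: ks.
- rewrite /X (jump_flow_epoch _ _ _ _ ks)//.
  case: h => [[j /= jm [js]]|[ms]].
    by rewrite (@trivIset_epoch _ _ _ _ beta_gt0 s j k)//; exists w.
  suff -> : k = m by [].
  move: km; rewrite leq_eqVlt => /orP[/eqP //|km].
  have /andP[_ sk] := ks.
  by have := lt_le_trans sk (le_trans (arrival_le beta_gt0 w km) ms); rewrite ltxx.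
Qed.

End history_measurability.

(** * Landing probabilities after a given number of jumps *)

Section landing.
Context {R : realType} {V : completeNormedModType R}.
Variables (T : R -> V -> V) (lam : probability R R) (mu : probability (borel V) R).

(** The conditional probability that a path starting from [v] has made exactly [k]
    jumps up to time [h] and is then in [B], given that its first waiting time
    and jump are the two components of [z].  Leaving the first pair [z] free,
    rather than integrating it out at once, is what allows the memoryless
    property to act on it. *)
Fixpoint landing (B : set (borel V)) (k : nat) (h : R) (v : V) (z : R * borel V) : \bar R :=
  if k is k'.+1 then
    (\int[lam \x mu]_z' landing B k' (h - z.1)%R (Tplus T z.1 v + (z.2 : V))%R z')%E
  else (\1_`[0, +oo[ h * \1_`]0, +oo[ (z.1 - h) * \1_B (Tplus T h v))%:E.

Lemma landing_ge0 B k h v z : (0 <= landing B k h v z)%E.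
Proof.
elim: k h v z => [|k IH] h v z /=; last exact: integral_ge0.
by rewrite lee_fin !mulr_ge0.
Qed.

Definition landing_prob B k h v : \bar R := (\int[lam \x mu]_z landing B k h v z)%E.

Lemma landing_prob_ge0 B k h v : (0 <= landing_prob B k h v)%E.
Proof. by apply: integral_ge0 => z _; exact: landing_ge0. Qed.

Hypotheses (V_separable : separable V) (Tc : time_continuous T) (Tn : contractive T).
Variables (B : set (borel V)) (mB : measurable B).

Lemma measurable_landing_prob_of k :
  measurable_fun setT (fun p : (R * borel V) * (R * borel V) =>
    landing B k p.1.1 p.1.2 p.2) ->
  measurable_fun setT (fun q : R * borel V => landing_prob B k q.1 q.2).
Proof.
move=> mk.
pose nu : probability (R * borel V)%type R := (lam \x mu)%E.
apply: (@measurable_fun_fubini_tonelli_F _ _ _ _ _ nu _ mk) => p; exact: landing_ge0.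
Qed.

Lemma measurable_landing k :
  measurable_fun setT (fun p : (R * borel V) * (R * borel V) =>
    landing B k p.1.1 p.1.2 p.2).
Proof.
elim: k => [|k IH] /=.
  apply/measurable_EFinP; apply: measurable_funM; first apply: measurable_funM.
  - apply: (measurableT_comp (f := \1_`[0, +oo[ : R -> R)) => //.
    by do 2 apply: measurableT_comp => //.
  - apply: (measurableT_comp (f := \1_`]0, +oo[ : R -> R)) => //.
    by apply: measurable_funB; do 2 apply: measurableT_comp => //.
  - apply: (measurableT_comp (f := \1_B : borel V -> R)) => //.
    by apply: measurable_fun_Tplus => //; do 2 apply: measurableT_comp => //.
apply: (measurableT_comp (f := fun q : R * borel V => landing_prob B k q.1 q.2)
  (g := fun p : (R * borel V) * (R * borel V) =>
    (p.1.1 - p.2.1, Tplus T p.2.1 p.1.2 + (p.2.2 : V) : borel V))).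
  exact: measurable_landing_prob_of.
apply: measurable_fun_pair.
  by apply: measurable_funB; do 2 apply: measurableT_comp => //.
apply: measurable_fun_borelD => //.
  apply: measurable_fun_Tplus => //; do 2 apply: measurableT_comp => //.
by do 2 apply: measurableT_comp => //.
Qed.

Lemma measurable_landing_prob k :
  measurable_fun setT (fun q : R * borel V => landing_prob B k q.1 q.2).
Proof. apply: measurable_landing_prob_of; exact: measurable_landing. Qed.

Hypothesis T_semigroup : semigroup T.

(** If no jump has occurred by time [s], the path up to [s] is deterministic:
    restarting the clock at [s] moves the state to [Tplus T s v] and shortens
    the first waiting time by [s]. *)
Lemma landing_shift k s h v z : 0 <= s -> 0 <= h -> s < z.1 ->
  landing B k (s + h) v z = landing B k h (Tplus T s v) (z.1 - s, z.2).
Proof.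
move=> s0 h0 sz; case: k => [|k] /=.
  rewrite (addrC s h) TplusD// !indicE !mem_setE !in_itv/= !andbT h0 addr_ge0//.
  by have -> : z.1 - s - h = z.1 - (h + s) by lra.
have -> : Tplus T z.1 v = Tplus T (z.1 - s) (Tplus T s v).
  by rewrite -TplusD// ?subrK// subr_ge0 ltW.
by have -> : s + h - z.1 = h - (z.1 - s) by lra.
Qed.

Variable theta : R.
Hypothesis lam_tail : forall y : R, 0 <= y ->
  lam `]y, +oo[%classic = (expR (- theta * y))%:E.

Lemma landing_memoryless k s h v : 0 <= s -> 0 <= h ->
  (\int[lam \x mu]_(z in [set z | (s < z.1)%R]) landing B k (s + h)%R v z =
   lam `]s, +oo[%classic * landing_prob B k h (Tplus T s v))%E.
Proof.
move=> s0 h0.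
rewrite -(memoryless_integral lam_tail mu (f := landing B k h (Tplus T s v)))//.
- by apply: eq_integral => z; rewrite inE/= => sz; exact: landing_shift.
- apply: (measurableT_comp (f := fun p : (R * borel V) * (R * borel V) =>
    landing B k p.1.1 p.1.2 p.2) (g := fun z => ((h, Tplus T s v : borel V), z))).
    exact: measurable_landing.
  by apply: measurable_fun_pair => //.
- by move=> z; exact: landing_ge0.
Qed.

End landing.

(** * Renewal and the Markov identity *)

Lemma measure_partition {R : realType} {d} {Om : measurableType d}
    (P : {measure set Om -> \bar R}) (C N : set Om) (F : nat -> set Om) :
  measurable C -> (forall k, measurable (F k)) -> trivIset setT F ->
  measurable N -> P N = 0%E -> C `<=` \bigcup_k F k `|` N ->
  P C = (\sum_(k <oo) P (C `&` F k))%E.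
Proof.
move=> mC mF tF mN N0 CFN.
have mCF k : measurable (C `&` F k) by exact: measurableI.
rewrite -measure_semi_bigcup//; last 2 first.
- exact: trivIset_setIl.
- exact: bigcup_measurable.
apply/eqP; rewrite eq_le; apply/andP; split; last first.
  apply: le_measure; rewrite ?inE//; first exact: bigcup_measurable.
  by move=> w [k _ []].
apply: (@le_trans _ _ (P ((\bigcup_k (C `&` F k)) `|` N))).
  apply: le_measure; rewrite ?inE//.
    by apply: measurableU => //; exact: bigcup_measurable.
  by move=> w Cw; case: (CFN w Cw) => [[k _ Fk]|]; [left; exists k|right].
rewrite -[leRHS]adde0 -[X in (_ + X)%E]N0 measureU2//.
exact: bigcup_measurable.
Qed.

Lemma ge0_integral_partition {R : realType} {d} {Om : measurableType d}
    (P : {measure set Om -> \bar R}) (C N : set Om) (F : nat -> set Om) (f : Om -> \bar R) :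
  measurable C -> (forall k, measurable (F k)) -> trivIset setT F ->
  measurable N -> P N = 0%E -> C `<=` \bigcup_k F k `|` N ->
  measurable_fun setT f -> (forall w, 0 <= f w)%E ->
  (\int[P]_(w in C) f w = \sum_(k <oo) \int[P]_(w in C `&` F k) f w)%E.
Proof.
move=> mC mF tF mN N0 CFN mf f0.
have mCF k : measurable (C `&` F k) by exact: measurableI.
have mU : measurable (\bigcup_k F k) by exact: bigcup_measurable.
rewrite -ge0_integral_bigcup//; last 2 first.
- exact: measurable_funTS.
- exact: trivIset_setIl.
rewrite -setI_bigcupr.
rewrite (@ge0_negligible_integral _ _ _ P C (C `\` \bigcup_k F k))//; last 3 first.
- exact: measurableD.
- exact: measurable_funTS.
- apply: (subset_measure0 _ _ _ N0) => //; first exact: measurableD.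
  by move=> w [/CFN[]].
by rewrite setDD.
Qed.

Lemma measurable_set_lt {R : realType} {d} {Om : measurableType d} (f g : Om -> R) :
  measurable_fun setT f -> measurable_fun setT g -> measurable [set w | f w < g w].
Proof.
move=> mf mg; rewrite (_ : mkset _ = ~` [set w | g w <= f w]).
  apply: measurableC; rewrite -[X in measurable X]setTI.
  exact: measurable_fun_le.
by apply/seteqP; split => w /=; rewrite ltNge => /negP.
Qed.

Section renewal.
Context {R : realType} {d} {Om : measurableType d} {V : completeNormedModType R}.
Variables (P : probability Om R) (T : R -> V -> V).
Hypotheses (V_separable : separable V) (T_semigroup : semigroup T)
  (T_continuous : time_continuous T) (T_contractive : contractive T).
Variables (eta : nat -> {RV P >-> borel V}) (beta : nat -> {RV P >-> R}) (theta : R).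
Hypotheses (eta_iid : iid P eta) (theta_gt0 : 0 < theta)
  (beta_gt0 : forall m w, 0 < beta m w) (beta_iid : iid P beta)
  (beta_exp : forall m (B : set R), measurable B ->
    distribution P (beta m) B = exponential_prob theta B)
  (eta_beta_indep :
    independent_algebras P (sigma_gen setT eta) (sigma_gen setT beta)).

Let lam := distribution P (beta 0%N).
Let mu := distribution P (eta 0%N).

Lemma waiting_time_tail (y : R) : 0 <= y -> lam `]y, +oo[%classic = (expR (- theta * y))%:E.
Proof.
rewrite le_eqVlt => /orP[/eqP<-|y0].
  rewrite mulr0 expR0 /lam /distribution /pushforward.
  rewrite (_ : _ @^-1` _ = setT) ?probability_setT//.
  by apply/seteqP; split => // w _ /=; rewrite in_itv/= beta_gt0.
have -> : lam `]y, +oo[%classic = (1 - lam `[0%R, y]%classic)%E.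
  rewrite -probability_setC//; rewrite /lam /distribution /pushforward.
  congr (P _); apply/seteqP; split => w /=; rewrite !in_itv/= andbT.
    by move=> yw; apply/negP; rewrite negb_and -!ltNge yw orbT.
  by rewrite (ltW (beta_gt0 _ _))/= => /negP; rewrite -ltNge.
by rewrite /lam beta_exp// exponential_prob_itv0c// oppeB// addeA subee// add0e.
Qed.

Lemma waiting_time_le (y : R) : 0 <= y -> lam `]-oo, y]%classic = (1 - expR (- theta * y))%:E.
Proof.
move=> y0; rewrite -setCitvr [LHS]probability_setC// EFinB.
by rewrite -[X in (1 - X)%E]/(lam `]y, +oo[%classic) waiting_time_tail.
Qed.

(** If all arrivals are at most [t], so are the waiting times; the first [n] of
    them are so with probability [r ^+ n] for some [r < 1]. *)
Lemma no_explosion t : P (\bigcap_n [set w | arrival beta n w <= t]) = 0%E.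
Proof.
have [t0|t0] := ltP t 0.
  rewrite (_ : \bigcap_n _ = set0) ?measure0//; apply/seteqP; split => // w.
  by move=> /(_ 0%N Logic.I); rewrite /= arrival0 leNgt t0.
set D := \bigcap_n _.
have mD : measurable D by apply: bigcapT_measurable => n; exact: measurable_arrived.
(* The probability that one waiting time is at most [t]. *)
pose r := 1 - expR (- theta * t).
have r0 : 0 <= r by rewrite subr_ge0 -expR0 ler_expR mulNr oppr_le0 mulr_ge0// ltW.
have r1 : r < 1 by rewrite ltrBlDr ltrDl expR_gt0.
have Dr n : (P D <= (r ^+ n)%:E)%E.
  have DC : (P D <= P (cylinder eta beta 0 n (fun=> `]-oo, t]%classic) (fun=> setT)))%E.
    apply: le_measure; rewrite ?inE//; first exact: measurable_cylinder.
    move=> w Dw i _; split=> //=; rewrite in_itv/= add0n.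
    apply: le_trans (Dw i.+1 Logic.I); rewrite arrivalS lerDr.
    exact: arrival_ge0.
  apply: (le_trans DC).
  have [-> _] := probability_cylinder0 eta_iid beta_iid eta_beta_indep n
    (B := fun=> `]-oo, t]%classic) (C := fun=> setT)
    (fun=> measurable_itv _) (fun=> measurableT).
  rewrite (eq_bigr (fun=> r%:E)); last first.
    by move=> i _; rewrite [X in (_ * X)%E]probability_setT mule1; exact: waiting_time_le.
  by rewrite prodEFin prodr_const card_ord.
apply/eqP; rewrite eq_le measure_ge0 andbT -(@fineK _ (P D)) ?fin_num_measure// lee_fin.
apply: (@cvgr_to_ge _ \oo _ _ (fun n => r ^+ n)).
  by apply: cvg_expr; rewrite ger0_norm.
by apply: nearW => n; rewrite -lee_fin fineK ?fin_num_measure.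
Qed.

Lemma independent_initial_cst v : independent_initial P eta beta (cst v).
Proof.
move=> A C [B mB <-] _; rewrite setTI.
have [Bv|Bv] := pselect (B v).
  by rewrite (_ : _ @^-1` _ = setT) ?setTI ?probability_setT ?mul1e//; apply/seteqP; split.
by rewrite (_ : _ @^-1` _ = set0) ?set0I ?measure0 ?mul0e//; apply/seteqP; split.
Qed.

Section initial.
Variables (x : Om -> borel V) (mx : measurable_fun setT x).
Hypothesis x_indep : independent_initial P eta beta x.

Notation Hm m := (g_sigma_algebraType (history eta beta x m)).
Let X := jump_flow T eta beta x.
Let a := arrival beta.
Let c := jump_chain T eta beta x.

Lemma freeze_next m A d' (E : measurableType d') (y : Om -> E)
    (f : E * (R * borel V) -> \bar R) :
  <<s history eta beta x m >> A -> measurable_fun setT (y : Hm m -> E) ->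
  measurable_fun setT f -> (forall p, 0 <= f p)%E ->
  (\int[P]_(w in A) f (y w, (beta m w, eta m w)) =
   \int[P]_(w in A) \int[lam \x mu]_z f (y w, z))%E.
Proof.
move=> hA my mf f0.
pose nu : probability (R * borel V)%type R := (lam \x mu)%E.
apply: (@freezing _ _ _ _ _ P (history eta beta x m)
  (fun w => (beta m w, eta m w)) nu _ _ _ A
  (fun p => f (y p.1, p.2))) => //.
- exact: history_measurable.
- exact: measurable_fun_pair.
- move=> A' D hA' mD.
  exact: (history_independent_next mx eta_iid beta_iid eta_beta_indep x_indep).
- apply: measurableT_comp => //; apply: measurable_fun_pair => //.
  exact: measurableT_comp.
Qed.

Lemma measurable_elapsed_chain m u :
  measurable_fun setT ((fun w => (u - a m w, c m w : borel V)) : Hm m -> R * borel V).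
Proof.
apply: measurable_fun_pair.
  apply: (@measurable_funB _ (Hm m)); first exact: measurable_cst.
  exact: measurable_history_arrival.
exact: measurable_history_chain.
Qed.

Variables (B : set (borel V)) (mB : measurable B).

(** Induction on [k]: conditioning on the history up to arrival [m.+1], with
    [m.+1] as the new origin, integrates out the pair number [m.+1].  The events
    [A] may depend on the pair number [m], which is why [landing] is evaluated
    at the actual pair; this is used with [A] contained in [epoch m t]. *)
Lemma renewal k m A u : <<s history eta beta x m.+1 >> A ->
  P (A `&` (epoch beta (m + k) u `&` X u @^-1` B)) =
  (\int[P]_(w in A) landing T lam mu B k (u - a m w)%R (c m w) (beta m w, eta m w))%E.
Proof.
elim: k m A => [|k IH] m A hA.
  have mA := gen_history_measurable mx hA.
  have mE : measurable (epoch beta (m + 0) u `&` X u @^-1` B).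
    apply: measurableI; first exact: measurable_epoch.
    rewrite -[X in measurable X]setTI.
    exact: measurable_jump_flow.
  rewrite setIC -integral_indic//; apply: eq_integral => w _ /=; congr _%:E.
  rewrite !indicE !mem_setE !in_itv/= !andbT.
  have [ew|ew] := pselect (epoch beta m u w); last first.
    rewrite memNset; last by rewrite addn0 => -[].
    have : ~~ ((0 <= u - a m w) && (0 < beta m w - (u - a m w))).
      apply/negP => /andP[]; rewrite /a => h1 h2; apply: ew.
      by rewrite /epoch/= arrivalS; apply/andP; split; lra.
    by rewrite negb_and => /orP[]/negbTE ->; rewrite ?mul0r// mulr0 mul0r.
  have : (0 <= u - a m w) && (0 < beta m w - (u - a m w)).
    move: (ew); rewrite /epoch/= arrivalS => /andP[h1 h2].
    by rewrite /a; apply/andP; split; lra.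
  move=> /andP[-> ->]; rewrite !mul1r; congr (_%:R); congr nat_of_bool.
  apply/idP/idP; rewrite !inE/= addn0.
    by move=> [_]; rewrite /X (jump_flow_epoch _ _ _ _ ew).
  by move=> Bw; split => //; rewrite /X (jump_flow_epoch _ _ _ _ ew).
rewrite addnS -addSn IH; last exact: gen_historyS.
have mp := measurable_landing lam mu V_separable T_continuous T_contractive mB k.
pose f (p : (R * borel V) * (R * borel V)) := landing T lam mu B k p.1.1 p.1.2 p.2.
have fE := freeze_next hA (measurable_elapsed_chain u) (f := f) mp
  (fun p => landing_ge0 _ _ _ _ _ _ _ _).
apply: (etrans fE).
apply: eq_integral => w _ /=; apply: eq_integral => z _.
rewrite /a arrivalS opprD addrA /c; congr (landing _ _ _ _ _ _ _ _).
by rewrite jump_chainS.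
Qed.

(** The event [epoch m t] is not in history [m]: it also asks that waiting time
    number [m] exceeds the time elapsed since arrival [m].  Integrating out the
    pair turns this condition into a domain of integration. *)
Lemma freeze_epoch m A (t : R) (f : (R * borel V) * (R * borel V) -> \bar R) :
  <<s history eta beta x m >> A -> measurable_fun setT f -> (forall p, 0 <= f p)%E ->
  (\int[P]_(w in A `&` epoch beta m t) f ((t - a m w)%R, c m w, (beta m w, eta m w)) =
   \int[P]_(w in A `&` [set w | (a m w <= t)%R])
     \int[lam \x mu]_(z in [set z | t - a m w < z.1]%R) f ((t - a m w)%R, c m w, z))%E.
Proof.
move=> hA mf f0.
pose D := [set p : (R * borel V) * (R * borel V) | p.1.1 < p.2.1].
have mD : measurable D.
  by apply: measurable_set_lt => //; do 2 apply: measurableT_comp => //.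
have -> : A `&` epoch beta m t = (A `&` [set w | a m w <= t]) `&`
    [set w | D ((t - a m w, c m w), (beta m w, eta m w))].
  apply/seteqP; split => w /=; rewrite /epoch/D/= arrivalS.
    by move=> [Aw /andP[h1 h2]]; split => //; rewrite /a; lra.
  move=> [[Aw]]; rewrite /a => h1 h2; split => //.
  by apply/andP; split; lra.
rewrite integral_mkcondr.
rewrite [LHS](_ : _ = \int[P]_(w in A `&` [set w | (a m w <= t)%R])
  (f \_ D) ((t - a m w, c m w)%R, (beta m w, eta m w)))%E; last first.
  by apply: eq_integral => w _; rewrite !patchE !mem_setE.
have mfD : measurable_fun setT (f \_ D).
  by apply/(measurable_restrict _ _ _) => //; exact: measurable_funTS.
have fD0 p : (0 <= (f \_ D) p)%E by rewrite patchE; case: ifP.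
have hAt : <<s history eta beta x m >> (A `&` [set w | a m w <= t]).
  by apply: (@measurableI _ (Hm m)) => //; exact: history_arrived.
have mac : measurable_fun setT ((fun w => (t - a m w, c m w : borel V)) : Hm m -> R * borel V).
  exact: measurable_elapsed_chain.
apply: etrans; first exact: (freeze_next hAt mac mfD fD0).
apply: eq_integral => w _; rewrite [RHS]integral_mkcond.
by apply: eq_integral => z _; rewrite !patchE !mem_setE.
Qed.

(** Both sides are integrals over the same history event of [A] and arrival [m] up
    to [t]: on the left the memoryless property produces the tail probability of
    the elapsed time as a factor, on the right the same factor is the conditional
    probability that no jump occurs between arrival [m] and [t]. *)
Lemma markov_epoch m k A t h : <<s history eta beta x m >> A -> 0 <= t -> 0 <= h ->
  P ((A `&` epoch beta m t) `&` (epoch beta (m + k) (t + h) `&` X (t + h) @^-1` B)) =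
  (\int[P]_(w in A `&` epoch beta m t) landing_prob T lam mu B k h (X t w))%E.
Proof.
move=> hA t0 h0.
have mp := measurable_landing lam mu V_separable T_continuous T_contractive mB k.
have mq := measurable_landing_prob lam mu V_separable T_continuous T_contractive mB k.
rewrite renewal; last first.
  apply: (@measurableI _ (Hm m.+1)); first exact: gen_historyS.
  exact: history_epoch.
pose f1 (p : (R * borel V) * (R * borel V)) := landing T lam mu B k (p.1.1 + h) p.1.2 p.2.
pose f2 (p : (R * borel V) * (R * borel V)) :=
  landing_prob T lam mu B k h (Tplus T p.1.1 p.1.2).
have mf1 : measurable_fun setT f1.
  apply: (measurableT_comp (f := fun p : (R * borel V) * (R * borel V) =>
     landing T lam mu B k p.1.1 p.1.2 p.2)
    (g := fun p : (R * borel V) * (R * borel V) => ((p.1.1 + h, p.1.2), p.2))) => //.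
  do 2 apply: measurable_fun_pair => //; last by apply: measurableT_comp.
  by apply: measurable_funD => //; apply: measurableT_comp.
have mf2 : measurable_fun setT f2.
  apply: (measurableT_comp (f := fun q : R * borel V => landing_prob T lam mu B k q.1 q.2)
    (g := fun p : (R * borel V) * (R * borel V) => (h, Tplus T p.1.1 p.1.2 : borel V))) => //.
  apply: measurable_fun_pair => //.
  by apply: measurable_fun_Tplus => //; do 2 apply: measurableT_comp => //.
have E1 := freeze_epoch t hA mf1 (fun p => landing_ge0 _ _ _ _ _ _ _ _).
have E2 := freeze_epoch t hA mf2 (fun p => landing_prob_ge0 _ _ _ _ _ _ _).
transitivity (\int[P]_(w in A `&` epoch beta m t)
  f1 ((t - a m w)%R, c m w, (beta m w, eta m w)))%E.
  by apply: eq_integral => w _; rewrite /f1/=; congr landing; rewrite addrAC.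
transitivity (\int[P]_(w in A `&` epoch beta m t)
  f2 ((t - a m w)%R, c m w, (beta m w, eta m w)))%E; last first.
  apply: eq_integral => w; rewrite inE => -[_ ew].
  by rewrite /f2/= /X (jump_flow_epoch _ _ _ _ ew).
rewrite E1 E2.
apply: eq_integral => w; rewrite inE/= => -[_ aw].
have s0 : 0 <= t - a m w by rewrite subr_ge0.
rewrite (landing_memoryless mu V_separable T_continuous T_contractive mB T_semigroup
  waiting_time_tail)//.
rewrite /f2/= [RHS]integral_cst; last exact: measurable_tail_strip.
by rewrite muleC; congr (_ * _)%E; rewrite -(product_measure_tail_strip lam mu).
Qed.

Lemma markov_from_epoch m A t h : <<s history eta beta x m >> A -> 0 <= t -> 0 <= h ->
  P ((A `&` epoch beta m t) `&` X (t + h) @^-1` B) =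
  (\int[P]_(w in A `&` epoch beta m t)
     \sum_(k <oo) landing_prob T lam mu B k h (X t w))%E.
Proof.
move=> hA t0 h0.
have mX u : measurable_fun setT (X u : Om -> borel V) by exact: measurable_jump_flow.
have mXB : measurable (X (t + h) @^-1` B).
  by rewrite -[X in measurable X]setTI; exact: mX.
have mAe : measurable (A `&` epoch beta m t).
  apply: measurableI; [exact: gen_history_measurable hA|exact: measurable_epoch].
have mN : measurable (\bigcap_n [set w | arrival beta n w <= t + h]).
  by apply: bigcapT_measurable => n; exact: measurable_arrived.
rewrite (@measure_partition _ _ _ P _ _ (fun k => epoch beta (m + k) (t + h)) _ _ _ mN)//.
- rewrite integral_nneseries//.
  + apply: eq_eseriesr => k _; rewrite -setIA [X in _ `&` X]setIC; exact: markov_epoch.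
  + move=> k; apply: measurable_funTS.
    apply: (measurableT_comp (f := fun q : R * borel V => landing_prob T lam mu B k q.1 q.2)
      (g := fun w => (h, X t w))) => //.
      exact: measurable_landing_prob.
    exact: measurable_fun_pair.
  + by move=> k w _; exact: landing_prob_ge0.
- exact: measurableI.
- by move=> k; exact: measurable_epoch.
- move=> i j _ _ ij; apply/eqP; rewrite -(eqn_add2l m); apply/eqP.
  exact: (trivIset_epoch beta_gt0 (t := t + h)).
- exact: no_explosion.
- move=> w [[_ /andP[aw _]] _].
  have [|H|[k kw]] := @epoch_from _ _ _ _ beta_gt0 m (t + h) w; last 2 first.
  + by right => n _; exact: H.
  + by left; exists k.
  + by rewrite (le_trans aw)// lerDl.
Qed.

End initial.

(** The renewal formula for a constant initial state, at the origin and over the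
    whole space. *)
Lemma transitionE B h v : measurable B -> 0 <= h ->
  transition P T eta beta h v B = (\sum_(k <oo) landing_prob T lam mu B k h v)%E.
Proof.
move=> mB h0.
have mv : measurable_fun setT (cst v : Om -> borel V) by exact: measurable_cst.
have vi := @independent_initial_cst v.
have hT : <<s history eta beta (cst v) 0 >> setT.
  exact: (@measurableT _ (g_sigma_algebraType (history eta beta (cst v) 0))).
have mN : measurable (\bigcap_n [set w | arrival beta n w <= h]).
  by apply: bigcapT_measurable => n; exact: measurable_arrived.
have mXB : measurable (jump_flow T eta beta (cst v) h @^-1` B).
  by rewrite -[X in measurable X]setTI; exact: measurable_jump_flow.
rewrite /transition.
rewrite (@measure_partition _ _ _ P _ _ (fun k => epoch beta k h) _ _ _ mN)//.
- apply: eq_eseriesr => k _; rewrite setIC.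
  have := renewal mv vi mB k (m := 0) (A := setT) h (gen_historyS hT).
  rewrite add0n setTI => rE; apply: etrans; first exact: rE.
  pose f (p : unit * (R * borel V)) := landing T lam mu B k h v p.2.
  have mf : measurable_fun setT f.
    apply: (measurableT_comp (f := fun p : (R * borel V) * (R * borel V) =>
       landing T lam mu B k p.1.1 p.1.2 p.2)
      (g := fun p : unit * (R * borel V) => ((h, v), p.2))) => //.
      exact: measurable_landing.
    exact: measurable_fun_pair.
  have fE := freeze_next mv vi hT (y := fun=> tt)
    (measurable_cst tt) mf (fun p => landing_ge0 _ _ _ _ _ _ _ _).
  transitivity (\int[P]_w f (tt, (beta 0%N w, eta 0%N w)))%E.
    by apply: eq_integral => w _; rewrite /f/= arrival0 subr0.
  by rewrite fE /f/= integral_cst// [X in (_ * X)%E]probability_setT mule1.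
- by move=> k; exact: measurable_epoch.
- exact: trivIset_epoch.
- exact: no_explosion.
- move=> w _.
  have [|H|[k kw]] := @epoch_from _ _ _ _ beta_gt0 0 h w; last 2 first.
  + by right => n _; exact: H.
  + by left; exists k.
  + by rewrite arrival0.
Qed.

Lemma measurable_transition B : measurable B ->
  measurable_fun ((`[0, +oo[ : set R) `*` [set: borel V])
    (fun p : R * borel V => transition P T eta beta p.1 p.2 B).
Proof.
move=> mB.
apply: (eq_measurable_fun (fun p : R * borel V =>
  \sum_(k <oo) landing_prob T lam mu B k p.1 p.2)%E).
  move=> [h v]; rewrite inE/= in_itv/= andbT => -[h0 _].
  by rewrite transitionE.
apply: measurable_funTS; apply: ge0_emeasurable_sum => [k p _ _|k _].
  exact: landing_prob_ge0.
exact: measurable_landing_prob.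
Qed.

Lemma measurable_transition_at B h : measurable B -> 0 <= h ->
  measurable_fun setT (fun v : borel V => transition P T eta beta h v B).
Proof.
move=> mB h0.
apply: (eq_measurable_fun (fun v : borel V =>
  \sum_(k <oo) landing_prob T lam mu B k h v)%E).
  by move=> v _; rewrite transitionE.
apply: ge0_emeasurable_sum => [k p _ _|k _]; first exact: landing_prob_ge0.
apply: (measurableT_comp (f := fun q : R * borel V => landing_prob T lam mu B k q.1 q.2)
      (g := fun v => (h, v))) => //.
  exact: measurable_landing_prob.
exact: measurable_fun_pair.
Qed.

(** The epochs exhaust the space up to a null event, and on each of them [A] can be
    traded for an event of the history, to which the previous results apply. *)
Lemma markov_identity x A B t h : measurable_fun setT x -> independent_initial P eta beta x ->
  measurable B -> 0 <= t -> 0 <= h ->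
  sigma_gen `[0, t] (jump_flow T eta beta x) A ->
  P (A `&` jump_flow T eta beta x (t + h) @^-1` B) =
  (\int[P]_(w in A) transition P T eta beta h (jump_flow T eta beta x t w) B)%E.
Proof.
move=> mx x_indep mB t0 h0 sA.
set X := jump_flow T eta beta x.
have mX u : measurable_fun setT (X u : Om -> borel V) by exact: measurable_jump_flow.
have mXB : measurable (X (t + h) @^-1` B).
  by rewrite -[X in measurable X]setTI; exact: mX.
have mN : measurable (\bigcap_n [set w | arrival beta n w <= t]).
  by apply: bigcapT_measurable => n; exact: measurable_arrived.
have mA : measurable A.
  apply: (smallest_sub (@sigma_algebra_measurable _ Om) _ sA).
  by move=> _ [s _ [C mC <-]]; exact: mX.
have cover w : (\bigcup_k epoch beta k t `|` \bigcap_n [set w | arrival beta n w <= t]) w.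
  have [|H|[k kw]] := @epoch_from _ _ _ _ beta_gt0 0 t w; last 2 first.
  + by right => n _; exact: H.
  + by left; exists k.
  + by rewrite arrival0.
have mf : measurable_fun setT (fun w => transition P T eta beta h (X t w) B).
  apply: (measurableT_comp (f := fun v : borel V => transition P T eta beta h v B)) => //.
  exact: measurable_transition_at.
have N0 := no_explosion t.
have mE k : measurable (epoch beta k t) by exact: measurable_epoch.
have tE := trivIset_epoch beta_gt0 (t := t).
rewrite (measure_partition (measurableI _ _ mA mXB) mE tE mN N0 (fun w _ => cover w)).
rewrite (ge0_integral_partition mA mE tE mN N0 (fun w _ => cover w) mf)//.
apply: eq_eseriesr => m _.
have [A' hA' AA'] := natural_history_trace V_separable T_continuous
  T_contractive beta_gt0 m sA.
rewrite setIAC AA'; apply: etrans; first exact: markov_from_epoch.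
by apply: eq_integral => w _; rewrite transitionE.
Qed.

Lemma measurable_flow_preimage (x : Om -> borel V) t B :
  measurable_fun setT x -> measurable B ->
  measurable (jump_flow T eta beta x t @^-1` B).
Proof.
move=> mx mB; rewrite -[X in measurable X]setTI.
exact: measurable_jump_flow.
Qed.

Lemma transition_ge0_le1 t v B : measurable B ->
  (0 <= transition P T eta beta t v B <= 1)%E.
Proof.
move=> mB; rewrite measure_ge0/=; apply: probability_le1.
by apply: measurable_flow_preimage => //; exact: measurable_cst.
Qed.

Lemma transition_fin_num t v B : measurable B ->
  transition P T eta beta t v B \is a fin_num.
Proof.
move=> mB; rewrite fin_num_measure//.
by apply: measurable_flow_preimage => //; exact: measurable_cst.
Qed.

Lemma transition_probability t v : exists nu : probability (borel V) R,
  forall B, measurable B -> transition P T eta beta t v B = nu B.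
Proof.
have mv : measurable_fun setT (jump_flow T eta beta (cst v) t : Om -> borel V).
  by apply: measurable_jump_flow => //; exact: measurable_cst.
pose Xv : {mfun Om >-> borel V} := HB.pack (jump_flow T eta beta (cst v) t)
  (isMeasurableFun.Build _ _ _ _ _ mv).
by exists (distribution P Xv).
Qed.

Lemma jump_flow0 (x : Om -> borel V) w : jump_flow T eta beta x 0 w = x w.
Proof.
rewrite (jump_flow_epoch T eta x beta_gt0 (m := 0)).
  by rewrite arrival0 subr0 Tplus0.
by rewrite /epoch/= arrivalS arrival0 lexx add0r beta_gt0.
Qed.

Lemma transition0 v B : measurable B ->
  transition P T eta beta 0 v B = (\1_B v)%:E.
Proof.
move=> mB; rewrite /transition.
rewrite (_ : _ @^-1` _ = [set w | B v]); last first.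
  by apply/seteqP; split => w /=; rewrite jump_flow0.
rewrite indicE; have [Bv|Bv] := pselect (B v).
  rewrite mem_set// (_ : [set _ | _] = setT) ?probability_setT//.
  by apply/seteqP; split.
rewrite memNset// (_ : [set _ | _] = set0) ?measure0//.
by apply/seteqP; split.
Qed.

(** The Markov identity for the constant initial state [v] over the whole space:
    the transition function at [(t, v)] is the law of the process at [t]. *)
Lemma chapman_kolmogorov t h v B : 0 <= t -> 0 <= h -> measurable B ->
  transition P T eta beta (t + h) v B =
  (\int[transition P T eta beta t v]_y transition P T eta beta h y B)%E.
Proof.
move=> t0 h0 mB.
have mv : measurable_fun setT (cst v : Om -> borel V) by exact: measurable_cst.
have vi := @independent_initial_cst v.
have sT : sigma_gen `[0, t] (jump_flow T eta beta (cst v)) setT.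
  exact: (@measurableT _ (g_sigma_algebraType _)).
have := markov_identity mv vi mB t0 h0 sT.
rewrite setTI => E; apply: etrans; first exact: E.
have mXv : measurable_fun setT (jump_flow T eta beta (cst v) t : Om -> borel V).
  exact: measurable_jump_flow.
pose Xv : {mfun Om >-> borel V} := HB.pack (jump_flow T eta beta (cst v) t)
  (isMeasurableFun.Build _ _ _ _ _ mXv).
rewrite -[RHS]/(\int[distribution P Xv]_y transition P T eta beta h y B)%E.
by rewrite ge0_integral_distribution//; exact: measurable_transition_at.
Qed.

Section conditional_law.
Variables (x : Om -> borel V) (mx : measurable_fun setT x).
Hypothesis x_indep : independent_initial P eta beta x.
Variables (t h : R) (B : set (borel V)).
Hypotheses (t_ge0 : 0 <= t) (h_ge0 : 0 <= h) (mB : measurable B).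

Let X := jump_flow T eta beta x.
Let Y w := fine (transition P T eta beta h (X t w) B).

Let YE : EFin \o Y = fun w => transition P T eta beta h (X t w) B.
Proof. by apply/funext => w; rewrite /= /Y fineK// transition_fin_num. Qed.

Let mYE : measurable_fun setT (EFin \o Y).
Proof.
rewrite YE.
apply: (measurableT_comp (f := fun v : borel V => transition P T eta beta h v B)).
  exact: measurable_transition_at.
exact: measurable_jump_flow.
Qed.

Let iY : P.-integrable setT (EFin \o Y).
Proof.
apply/integrableP; split => //.
apply: (@le_lt_trans _ _ (\int[P]_(w in setT) cst 1%E w)%E).
  apply: ge0_le_integral => //; first exact: measurableT_comp.
  move=> w _; rewrite -[leLHS]/(`|(EFin \o Y) w|)%E YE.
  by have /andP[? ?] := transition_ge0_le1 h (X t w) mB; rewrite gee0_abs.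
by rewrite integral_cst// mul1e [X in (X < _)%E]probability_setT ltry.
Qed.

Let Y_state (C : set R) : measurable C ->
  g_sigma_algebra_preimage (X t) (Y @^-1` C).
Proof.
move=> mC.
exists ((fun v : borel V => fine (transition P T eta beta h v B)) @^-1` C).
  rewrite -[X in measurable X]setTI.
  apply: (measurableT_comp (f := fine)) => //.
  exact: measurable_transition_at.
by rewrite setTI.
Qed.

Lemma natural_filtration_state C : measurable C ->
  sigma_gen `[0, t] X (X t @^-1` C).
Proof.
move=> mC; apply: sub_sigma_algebra; exists t.
  by rewrite /= in_itv/= t_ge0 lexx.
by exists C => //; rewrite setTI.
Qed.

Lemma cond_prob_natural :
  is_cond_prob P (sigma_gen `[0, t] X) (X (t + h) @^-1` B) Y.
Proof.
split=> // [C mC|C GC].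
  have [D mD <-] := Y_state mC.
  by rewrite setTI; exact: natural_filtration_state.
rewrite setIC (markov_identity mx x_indep mB t_ge0 h_ge0 GC).
by apply: eq_integral => w _; rewrite -[LHS]/((EFin \o Y) w) YE.
Qed.

Lemma cond_prob_state :
  is_cond_prob P (g_sigma_algebra_preimage (X t)) (X (t + h) @^-1` B) Y.
Proof.
split=> // C [D mD <-].
have [_ _ -> //] := cond_prob_natural.
by rewrite setTI; exact: natural_filtration_state.
Qed.

End conditional_law.

End renewal.

(** * Conditional probabilities and completion *)

Section conditional.
Context {R : realType} {d} {Om : measurableType d}.
Variable P : probability Om R.

(** Two versions are compared under the restriction of [P] to [G], for which
    integrals over all measurable sets determine a function almost
    everywhere. *)
Lemma is_cond_prob_ae (G : set (set Om)) A Y1 Y2 : Defs.sub_sigma_algebra G ->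
  is_cond_prob P G A Y1 -> is_cond_prob P G A Y2 -> {ae P, forall w, Y1 w = Y2 w}.
Proof.
move=> [sG Gm] [G1 i1 E1] [G2 i2 E2].
pose OG := g_sigma_algebraType G.
have mOG : (measurable : set (set OG)) = G by exact: measurable_g_measurableTypeE.
pose idG : {mfun Om >-> OG} := HB.pack (idfun : Om -> OG)
  (isMeasurableFun.Build _ _ _ _ _ (measurable_idG Gm)).
pose PG : probability OG R := distribution P idG.
have midG : measurable_fun setT (idG : Om -> OG) by [].
have mY Y : (forall B : set R, measurable B -> G (Y @^-1` B)) ->
    measurable_fun setT (EFin \o Y : OG -> \bar R).
  by move=> GY; apply/measurable_EFinP => _ B mB; rewrite setTI mOG; exact: GY.
have iY Y : (forall B : set R, measurable B -> G (Y @^-1` B)) ->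
    P.-integrable setT (EFin \o Y) -> PG.-integrable setT (EFin \o Y : OG -> \bar R).
  move=> GY /integrableP[_ iY]; apply/integrableP; split; first exact: mY.
  rewrite (@ge0_integral_distribution _ _ _ _ _ P idG)//.
  by apply: measurableT_comp => //; exact: mY.
have EY Y C : (forall B : set R, measurable B -> G (Y @^-1` B)) ->
    P.-integrable setT (EFin \o Y) -> G C ->
    (\int[PG]_(w in C) (EFin \o Y) w = \int[P]_(w in C) (Y w)%:E)%E.
  move=> GY iP GC; rewrite (integral_pushforward midG)//.
  - exact: mY.
  - by apply: integrableS iP => //; exact: (Gm _ GC).
  - by rewrite mOG.
have [N [mN N0 YN]] : ae_eq PG setT (EFin \o Y1) (EFin \o Y2).
  apply: integral_ae_eq => //; [exact: iY|exact: mY|move=> C _].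
  rewrite mOG => GC; rewrite !EY// E1// E2//.
exists N; split => //; first by have := Gm N; rewrite -mOG; apply.
move=> w /= Yw; apply: YN => /= H; apply: Yw.
by have [] := H Logic.I.
Qed.

Lemma sub_sigma_algebra_gen (G : set (set Om)) :
  G `<=` measurable -> Defs.sub_sigma_algebra <<s G >>.
Proof.
move=> Gm; split; first exact: smallest_sigma_algebra.
exact: smallest_sub (@sigma_algebra_measurable _ Om) Gm.
Qed.

Lemma sub_sigma_algebra_completion (G : set (set Om)) :
  Defs.sub_sigma_algebra G -> Defs.sub_sigma_algebra (sigma_completion P G).
Proof.
move=> [[G0 GD GU] Gm]; split; last by move=> A [].
split.
- split => //; exists set0 => //; by rewrite setYK measure0.
- move=> A [mA [B GB AB]]; split; first by rewrite setTD; exact: measurableC.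
  exists (setT `\` B); first exact: GD.
  rewrite -AB; congr (P _); apply/seteqP.
  rewrite /setY; split => w /=; rewrite /setD/=;
  by case: (pselect (A w)); case: (pselect (B w)); tauto.
- move=> F hF.
  pose F' i := sval (cid2 (hF i).2).
  have GF' i : G (F' i) by rewrite /F'; case: cid2.
  have FF' i : P (F i `+` F' i) = 0%E by rewrite /F'; case: cid2.
  have mF i : measurable (F i) by exact: (hF i).1.
  have mF' i : measurable (F' i) by exact: Gm.
  split; first exact: bigcupT_measurable.
  exists (\bigcup_i F' i); first exact: GU.
  have mFF i : measurable (F i `+` F' i).
    by rewrite /setY; apply: measurableU; exact: measurableD.
  apply: (@subset_measure0 _ _ _ P _ (\bigcup_i (F i `+` F' i))) => //.
  + by rewrite /setY; apply: measurableU; apply: measurableD; exact: bigcupT_measurable.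
  + exact: bigcupT_measurable.
  + move=> w [[[i _ Fi] nF]|[[i _ Fi] nF]]; exists i => //; [left|right]; split => // H;
      by apply: nF; exists i.
  + apply/negligibleP; first exact: bigcupT_measurable.
    apply: negligible_bigcup => i; apply/(negligibleP P (mFF i)); exact: FF'.
Qed.

Lemma eq_integral_setY0 (C D : set Om) (f : Om -> \bar R) :
  measurable C -> measurable D -> P (C `+` D) = 0%E ->
  measurable_fun setT f -> (forall w, 0 <= f w)%E ->
  (\int[P]_(w in C) f w = \int[P]_(w in D) f w)%E.
Proof.
move=> mC mD CD mf f0.
have mCD : measurable (C `+` D) by rewrite /setY; apply: measurableU; exact: measurableD.
rewrite (@ge0_negligible_integral _ _ _ P C (C `+` D))//; last exact: measurable_funTS.
rewrite (@ge0_negligible_integral _ _ _ P D (C `+` D))//; last exact: measurable_funTS.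
congr (integral _ _ _); apply/seteqP; rewrite /setY/setD; split => w /=;
by case: (pselect (C w)); case: (pselect (D w)); tauto.
Qed.

Lemma is_cond_prob_completion (G : set (set Om)) A Y : Defs.sub_sigma_algebra G ->
  measurable A -> (forall w, 0 <= Y w) -> is_cond_prob P G A Y ->
  is_cond_prob P (sigma_completion P G) A Y.
Proof.
move=> [[G0 GD GU] Gm] mA Y0 [GY iY EY]; split => //.
  move=> B mB; split; first exact/Gm/GY.
  by exists (Y @^-1` B); [exact: GY|rewrite setYK measure0].
move=> C [mC [D GD' CD]].
have mD := Gm _ GD'.
have mY : measurable_fun setT (EFin \o Y) by exact: measurable_int iY.
rewrite (eq_integral_setY0 mC mD CD mY); last by move=> w; rewrite lee_fin.
rewrite EY// -!integral_indic//.
apply/esym; apply: (eq_integral_setY0 mC mD CD) => //; exact/measurable_EFinP.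
Qed.

End conditional.

(** * The Markov process *)

Theorem theorem0p3p3 (R : realType) (d : measure_display)
  (Omega : measurableType d) (P : probability Omega R)
  (P_complete : measure_is_complete P)
  (V : completeNormedModType R) (V_separable : separable V)
  (T : R -> V -> V) (T_semigroup : semigroup T)
  (T_continuous : time_continuous T) (T_contractive : contractive T)
  (eta : nat -> {RV P >-> borel V}) (eta_iid : iid P eta)
  (theta : R) (theta_gt0 : 0 < theta)
  (beta : nat -> {RV P >-> R})
  (beta_gt0 : forall m w, 0 < beta m w)
  (beta_iid : iid P beta)
  (beta_exp : forall m (B : set R), measurable B ->
    distribution P (beta m) B = exponential_prob theta B)
  (eta_beta_indep :
    independent_algebras P (sigma_gen setT eta) (sigma_gen setT beta))
  (x : {RV P >-> borel V})
  (x_indep : independent_initial P eta beta x) :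
  let X := jump_flow T eta beta x in
  let F := completed_natural_filtration P X in
  let Q := transition P T eta beta in
  [/\ markov_process P F X,
      transition_function Q &
      time_homogeneous P F X (distribution P x) Q].
Proof.
move=> X F Q.
have mx : measurable_fun setT x by [].
have mX t : measurable_fun setT (X t : Omega -> borel V).
  exact: measurable_jump_flow.
have mXB t B : measurable B -> measurable (X t @^-1` B).
  by move=> mB; exact: measurable_flow_preimage.
have gen_sub t : Defs.sub_sigma_algebra (sigma_gen `[0, t] X).
  by apply: sub_sigma_algebra_gen => _ [s _ [C mC <-]]; exact: mX.
have F_sub t : Defs.sub_sigma_algebra (F t).
  exact: sub_sigma_algebra_completion.
have X_sub t : Defs.sub_sigma_algebra (g_sigma_algebra_preimage (X t)).
  split; last by move=> _ [C mC <-]; exact: mX.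
  exact: (sigma_algebra_measurable (g_sigma_algebra_preimageType (X t))).
have condF t h B : 0 <= t -> 0 <= h -> measurable B ->
    {ae P, forall w, cond_prob P (F t) (X (t + h) @^-1` B) w =
      fine (Q h (X t w) B)}.
  move=> t0 h0 mB; apply: (is_cond_prob_ae (F_sub t)).
    by apply: cond_probP => //; exact: mXB.
  apply: is_cond_prob_completion => //; first exact: mXB.
    by move=> w; rewrite fine_ge0// measure_ge0.
  exact: (cond_prob_natural V_separable T_semigroup T_continuous T_contractive
    eta_iid theta_gt0 beta_gt0 beta_iid beta_exp eta_beta_indep).
have condX t h B : 0 <= t -> 0 <= h -> measurable B ->
    {ae P, forall w,
      cond_prob P (g_sigma_algebra_preimage (X t)) (X (t + h) @^-1` B) w =
      fine (Q h (X t w) B)}.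
  move=> t0 h0 mB; apply: (is_cond_prob_ae (X_sub t)).
    by apply: cond_probP => //; exact: mXB.
  exact: (cond_prob_state V_separable T_semigroup T_continuous T_contractive
    eta_iid theta_gt0 beta_gt0 beta_iid beta_exp eta_beta_indep).
split.
- split.
  + split=> [t _|s t s0 st A [mA [B sB AB]]]; first exact: F_sub.
    split => //; exists B => //.
    move: B sB {AB}; apply: sub_sigma_algebra2 => A' [u us A'u].
    exists u => //; move: us; rewrite /= !in_itv/= => /andP[-> us].
    by rewrite (le_trans us).
  + move=> t B t0 mB; split; first exact: mXB.
    exists (X t @^-1` B); last by rewrite setYK measure0.
    exact: natural_filtration_state.
  + move=> t h B t0 h0 mB.
    apply: filterS2 (condF t h B t0 h0 mB) (condX t h B t0 h0 mB) => w.
    by move=> -> ->.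
- split.
  + by move=> t v _; exact: transition_probability.
  + by move=> v B mB; exact: transition0.
  + move=> B mB.
    exact: (measurable_transition V_separable T_continuous T_contractive
      eta_iid theta_gt0 beta_gt0 beta_iid beta_exp eta_beta_indep).
  + move=> t h v B t0 h0 mB.
    exact: (chapman_kolmogorov V_separable T_semigroup T_continuous
      T_contractive eta_iid theta_gt0 beta_gt0 beta_iid beta_exp
      eta_beta_indep).
- split.
  + move=> B mB; rewrite (_ : X 0 = x)//.
    by apply/funext => w; exact: jump_flow0.
  + move=> t h B t0 h0 mB.
    apply: filterS (condF t h B t0 h0 mB) => w ->.
    by rewrite fineK//; exact: transition_fin_num.
Qed.
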